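(* Let $F$ be a field, let $n$ be a positive integer, and let $A$ be a (unital) $F$-subalgebra of $M_n(F)$. If $A$ does not satisfy the standard polynomial $s_{2n-2}$, then $A$ is equivalent to a full block upper triangular matrix algebra; that is, there exist a positive integer $t$, positive integers $\ell_1,\dots,\ell_t$ with $\ell_1+\cdots+\ell_t=n$, and an $F$-algebra automorphism $\tau$ of $M_n(F)$ such that $\tau(A)=E_{(\ell_1,\dots,\ell_t)}(F)$.
   Context: $M_n(F)$ is the algebra of $n\times n$ matrices over $F$. Subalgebras of $M_n(F)$ are assumed to contain the identity matrix. Standard polynomial: $s_t(X_1,\dots,X_t)=\sum_{\sigma\in S_t}(\mathrm{sg}\,\sigma)X_{\sigma(1)}X_{\sigma(2)}\cdots X_{\sigma(t)}$, an element of the free associative $F$-algebra, where $S_t$ is the symmetric group and $\mathrm{sg}\,\sigma$ is the sign of $\sigma$ (for $t=0$ the formula gives $s_0=1$). An $F$-algebra $R$ satisfies $s_t$ if $s_t(r_1,\dots,r_t)=0$ for all $r_1,\dots,r_t\in R$. Full block upper triangular algebra: for positive integers $\ell_1,\dots,\ell_t$ with sum $n$, $E_{(\ell_1,\dots,\ell_t)}(F)$ is the subalgebra of $M_n(F)$ consisting of all matrices which, when partitioned into blocks according to $n=\ell_1+\cdots+\ell_t$, have arbitrary $(i,j)$ block in $M_{\ell_i\times\ell_j}(F)$ for $i\le j$ and zero $(i,j)$ block for $i>j$. Two $F$-subalgebras $A,A'$ of $M_n(F)$ are equivalent if there is an $F$-algebra automorphism $\tau$ of $M_n(F)$ (necessarily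 of the form $a\mapsto QaQ^{-1}$ with $Q$ invertible) such that $\tau(A)=A'$. *)

(* Defs.v *)
From HB Require Import structures.
From mathcomp Require Import all_boot all_order all_algebra all_fingroup.
Set Implicit Arguments.
Unset Strict Implicit.
Unset Printing Implicit Defensive.
Import GRing.Theory.
Local Open Scope ring_scope.

(* Value of the standard polynomial s_t at (r_0, ..., r_(t-1)).  The product is
   non-commutative and is taken in increasing order of i; s : 'S_t is coerced to
   its parity, so (-1) ^+ s is its sign. *)
Definition standard_poly (R : pzRingType) (t : nat) (r : 'I_t -> R) : R :=
  \sum_(s : 'S_t) (-1) ^+ s * \prod_(i < t) r (s i).

Definition satisfies_standard (R : pzRingType) (A : {pred R}) (t : nat) : Prop :=
  forall r : 'I_t -> R, (forall i, r i \in A) -> standard_poly r = 0.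

(* reshape_index l i is the index of the block containing row (or column) i
   when 0, ..., n-1 is cut into consecutive blocks of sizes l_0, l_1, ... *)
Definition block_upper_triangular (F : fieldType) (n : nat) (l : seq nat) :
    {pred 'M[F]_n} :=
  [pred M : 'M[F]_n | [forall i : 'I_n, forall j : 'I_n,
     (reshape_index l j < reshape_index l i)%N ==> (M i j == 0)]].

(* The algebra automorphism tau is a bijective, F-linear ring morphism, because
   'M[F]_n has an algebra structure only when n is syntactically a successor. *)
Definition equivalent (F : fieldType) (n : nat) (A A' : {pred 'M[F]_n}) : Prop :=
  exists tau : {rmorphism 'M[F]_n -> 'M[F]_n},
    [/\ scalable tau, bijective tau
      & forall b, b \in A' <-> exists2 a, a \in A & tau a = b].

(* Main.v *)
Require Import Defs.
From HB Require Import structures.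
From mathcomp Require Import all_boot all_order all_algebra all_fingroup all_field.
From mathcomp Require Import boolp zify.
Set Implicit Arguments.
Unset Strict Implicit.
Unset Printing Implicit Defensive.
Import GRing.Theory.
Local Open Scope ring_scope.

(* If th_1, ..., th_N anticommute and have square 0, then
   (sum_i r_i th_i) ^ N = s_N(r_1, ..., r_N) th_1 ... th_N, so that standard
   identities say that certain matrices with anticommuting entries are nilpotent.
   In this form Amitsur-Levitzki reads a ^ (2n) = 0 (Rosset's proof), and the
   identities of a submodule and of the quotient combine by adding exponents.

   Let n > 0 and suppose that A does not satisfy s_(2n-2) on V = F^n.  By
   additivity and Amitsur-Levitzki, A does not satisfy s_(2d-2) on any
   subquotient of dimension d > 0.  If V is simple, A is all of M_n(F):
   otherwise some non-scalar d commutes with A, and over an extension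
   containing an eigenvalue of d the algebra embeds into smaller matrices.  In
   general let U be a maximal submodule and a, b the actions on V / U and U.  If
   some element of A has b = 0 and a <> 0, then A contains every map vanishing on
   U, because otherwise V is the sum of two proper submodules, on each of which
   s_(2n-2) vanishes.  If not, let S be a simple submodule of U; by induction on
   V / S some element acts as 1 on V / U and maps U into S, and this forces
   V / U and S to be isomorphic.  Such a coincidence of the first and last
   diagonal blocks gives s_(2n-2) = 0, by polarising a ^ (2l) = 0.  So A contains
   the full first block row, and one concludes by induction on U. *)

(** * Standard polynomials with Grassmann coefficients *)

(** Vanishing squares form a separate clause because in characteristic 2 they do not follow from
    anticommutation. *)
Definition anticommuting (L : pzRingType) (O : L -> Prop) : Prop :=
  (forall x y, O x -> O y -> x * y = - (y * x)) /\ (forall x, O x -> x * x = 0).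

Section StandardPower.
Variables (T : pzRingType) (I : finType) (r th : I -> T).
Hypothesis th_anti : anticommuting (fun x => exists i, x = th i).
Hypothesis r_th_comm : forall i j, GRing.comm (r i) (th j).

Let thC i j : th i * th j = - (th j * th i).
Proof. by apply: th_anti.1; [exists i | exists j]. Qed.

Let thK i : th i * th i = 0.
Proof. by apply: th_anti.2; exists i. Qed.

Lemma anticomm_mul_prod_eq0 i s : i \in s -> th i * \prod_(j <- s) th j = 0.
Proof.
elim: s => // j s IH; rewrite inE big_cons mulrA => /orP[/eqP <-|/IH E].
  by rewrite thK mul0r.
by rewrite thC mulNr -mulrA E mulr0 oppr0.
Qed.

Lemma anticomm_prod_nuniq s : ~~ uniq s -> \prod_(j <- s) th j = 0.
Proof.
elim: s => //= j s IH; rewrite negb_and negbK big_cons => /orP[].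
  exact: anticomm_mul_prod_eq0.
by move/IH ->; rewrite mulr0.
Qed.

(** Moving [th (g j)] from the front to its place in the increasing product crosses [j] factors. *)
Lemma anticomm_prod_lift p (g : 'I_p.+1 -> I) (j : 'I_p.+1) :
  th (g j) * \prod_(k < p) th (g (lift j k)) = (-1) ^+ j * \prod_(k < p.+1) th (g k).
Proof.
elim: p g j => [|p IH] g j.
  by rewrite !ord1 expr0 mul1r big_ord_recl.
case: (unliftP ord0 j) => [j' ->|->]; last by rewrite expr0 mul1r [RHS]big_ord_recl.
rewrite big_ord_recl mulrA thC mulNr -mulrA.
have -> : lift (lift ord0 j') ord0 = ord0 by apply: val_inj.
have E k : lift (lift ord0 j') (lift ord0 k) = lift ord0 (lift j' k).
  by apply: val_inj; rewrite /= /bump /= !add1n ltnS addnS.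
under eq_bigr do rewrite E.
rewrite (IH (fun k => g (lift ord0 k))) [X in _ = _ * X]big_ord_recl /=.
rewrite /bump /= add1n exprS mulN1r mulNr; congr (- _).
by rewrite !mulrA; congr (_ * _); apply: commr_sign.
Qed.

(** Splitting off the image of 0 permits induction on [p], since the sign of a [lift_perm] is
    known. *)
Lemma lift_perm_exists p (s : 'S_p.+1) :
  exists s' : 'S_p, s = lift_perm ord0 (s ord0) s'.
Proof.
have D k : exists k', s (lift ord0 k) = lift (s ord0) k'.
  case: (unliftP (s ord0) (s (lift ord0 k))) => [k' E|]; first by exists k'.
  by move/perm_inj.
have [f fE] := choice D.
have f_inj : injective f.
  move=> k k' /(congr1 (lift (s ord0))); rewrite -!fE => /perm_inj.
  exact: lift_inj.
exists (perm f_inj); apply/permP => k.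
case: (unliftP ord0 k) => [k' ->|->]; last by rewrite lift_perm_id.
by rewrite lift_perm_lift permE fE.
Qed.

Lemma anticomm_prod_perm p (g : 'I_p -> I) (s : 'S_p) :
  \prod_(k < p) th (g (s k)) = (-1) ^+ s * \prod_(k < p) th (g k).
Proof.
elim: p g s => [|p IH] g s.
  by rewrite !big_ord0 (_ : s = 1%g) ?odd_perm1 ?mulr1 //; apply/permP => -[].
have [s' sE] := lift_perm_exists s.
rewrite big_ord_recl; move: (s ord0) sE => j ->.
under eq_bigr do rewrite lift_perm_lift.
rewrite (IH (fun k => g (lift j k))) mulrA.
rewrite commr_sign -mulrA anticomm_prod_lift mulrA.
by rewrite odd_lift_perm /= addbC signr_addb signr_odd.
Qed.

(** The injective maps with the same image as [f0] are the composites of [f0] with permutations, and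
    sorting the factors [th] produces the sign. *)
Lemma sum_same_image p (f0 : {ffun 'I_p -> I}) : injective f0 ->
  \sum_(f : {ffun 'I_p -> I} | injectiveb f && (f @: 'I_p == f0 @: 'I_p))
    \prod_(k < p) r (f k) * \prod_(k < p) th (f k)
  = standard_poly (fun k => r (f0 k)) * \prod_(k < p) th (f0 k).
Proof.
move=> f0_inj.
have [p0|p_gt0] := posnP p.
  subst p; rewrite (big_pred1 f0); last first.
    move=> f /=; have -> : f = f0 by apply/ffunP => -[].
    by rewrite !eqxx andbT; apply/injectiveP.
  rewrite !big_ord0 mulr1 /standard_poly (big_pred1 1%g).
    by rewrite big_ord0 odd_perm1 !mulr1.
  by move=> s; symmetry; apply/eqP/permP => -[].
pose h (s : 'S_p) := [ffun k => f0 (s k)].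
rewrite (reindex h); last first.
  have D (f : {ffun 'I_p -> I}) : f @: 'I_p = f0 @: 'I_p ->
      forall k, exists k', f k = f0 k'.
    move=> E k; have : f k \in f0 @: 'I_p by rewrite -E imset_f.
    by case/imsetP => k' _ ->; exists k'.
  (* [inv f] recovers the permutation from [f]. Neither the default [Ordinal p_gt0] nor the default
     permutation 1 is reached when [f] is injective with the image of [f0]; the former exists only
     for positive [p], whence the separate case above. *)
  pose inv (f : {ffun 'I_p -> I}) (k : 'I_p) : 'I_p :=
    odflt (Ordinal p_gt0) [pick k' | f0 k' == f k].
  have invP (f : {ffun 'I_p -> I}) k : f @: 'I_p = f0 @: 'I_p -> f0 (inv f k) = f k.
    move=> /D/(_ k)[k' E]; rewrite /inv; case: pickP => [k'' /eqP //|/(_ k')].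
    by rewrite E eqxx.
  exists (fun f : {ffun 'I_p -> I} => insubd (1%g : 'S_p) (finfun (inv f))).
    move=> s; rewrite inE => /andP[_ /eqP E].
    have F k : inv (h s) k = s k by apply: f0_inj; rewrite invP // ffunE.
    have G : finfun (inv (h s)) = pval s.
      by apply/ffunP => k; rewrite ffunE F pvalE.
    by apply: val_inj; rewrite G val_insubd (valP s).
  move=> f; rewrite inE => /andP[/injectiveP f_inj /eqP E].
  apply/ffunP => k; rewrite ffunE.
  rewrite -pvalE val_insubd; have -> : injectiveb (finfun (inv f)).
    apply/injectiveP => k1 k2; rewrite !ffunE => /(congr1 f0).
    by rewrite !invP //; apply: f_inj.
  by rewrite ffunE invP.
rewrite /standard_poly mulr_suml; apply: eq_big => [s|s _].
  apply/andP; split.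
    by apply/injectiveP => k1 k2; rewrite !ffunE => /f0_inj/perm_inj.
  apply/eqP/setP => x; apply/imsetP/imsetP => [[k _ ->]|[k _ ->]].
    by rewrite ffunE; exists (s k).
  by exists (s^-1 k)%g => //; rewrite ffunE permKV.
under eq_bigr do rewrite ffunE.
under [X in _ * X]eq_bigr do rewrite ffunE.
rewrite (anticomm_prod_perm f0) mulrA; congr (_ * _).
exact/commr_sym/commr_sym/commr_sign.
Qed.

(** In the expanded power, a map that is not injective repeats a factor [th], and its term
    vanishes. *)
Lemma expr_sum_inj p :
  (\sum_i r i * th i) ^+ p = \sum_(f : {ffun 'I_p -> I} | injectiveb f)
    \prod_(k < p) r (f k) * \prod_(k < p) th (f k).
Proof.
rewrite -[p in LHS]card_ord -prodr_const.
rewrite (eq_bigl xpredT) // bigA_distr_bigA /= [RHS]big_mkcond /=.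
apply: eq_bigr => f _; rewrite prodrM_comm //; case: ifPn => // /anticomm_prod_nuniq.
rewrite big_map => E.
suff -> : \prod_k th (f k) = 0 by rewrite mulr0.
by rewrite -E enumT [index_enum _]unlock.
Qed.

(** Grouped by image, the injective maps contribute values of the standard polynomial at distinct
    members of the family [r]. *)
Lemma expr_sum_eq0 p :
  (forall g : 'I_p -> I, injective g -> standard_poly (fun k => r (g k)) = 0) ->
  (\sum_i r i * th i) ^+ p = 0.
Proof.
move=> std0; rewrite expr_sum_inj.
rewrite (partition_big (fun f : {ffun 'I_p -> I} => f @: 'I_p) predT) //=.
apply: big1 => S _.
have [/existsP[f0 /andP[/injectiveP f0_inj /eqP <-]]|/existsPn noS] := boolP
    [exists f : {ffun 'I_p -> I}, injectiveb f && (f @: 'I_p == S)].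
  by rewrite sum_same_image // std0 // mul0r.
by apply: big_pred0 => f; apply/negbTE/noS.
Qed.

End StandardPower.

Lemma expr_sum_standard (T : pzRingType) N (r th : 'I_N -> T) :
  anticommuting (fun x => exists i, x = th i) ->
  (forall i j, GRing.comm (r i) (th j)) ->
  (\sum_i r i * th i) ^+ N = standard_poly r * \prod_i th i.
Proof.
move=> th_anti r_th_comm; rewrite expr_sum_inj //.
pose f0 : {ffun 'I_N -> 'I_N} := [ffun k => k].
have f0_inj : injective f0 by move=> k k'; rewrite !ffunE.
have := sum_same_image r th_anti f0_inj.
rewrite [standard_poly _](_ : _ = standard_poly r); last first.
  by congr standard_poly; apply: funext => k; rewrite ffunE.
rewrite [X in _ * X](eq_bigr th) => [<-|k _]; last by rewrite ffunE.
apply: eq_bigl => f; case: injectiveP => //= f_inj.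
suff E (g : {ffun 'I_N -> 'I_N}) : injective g -> g @: 'I_N = setT.
  by rewrite !E ?eqxx.
move=> g_inj; apply/eqP; rewrite eqEcard subsetT /= cardsT card_imset //.
Qed.

(** A matrix model of the Grassmann algebra, doubling the size at each step: the old generators act
    as [th] and [- th] on two copies, and the new one maps one copy identically to the other. Up to
    sign, the old top product reappears in the upper right block. *)
Lemma grassmann_generators (F : fieldType) N :
  exists k (th : 'I_N -> 'M[F]_k),
    anticommuting (fun x => exists i, x = th i) /\ \prod_i th i != 0.
Proof.
elim: N => [|N [k [th [[thC thK] th0]]]].
  exists 1, (fun _ => 0); split; first by split=> [x y|x] [[]].
  by rewrite big_ord0 oner_eq0.
exists (k + k)%N.
exists (fun i => oapp (fun j => block_mx (th j) 0 0 (- th j)) (block_mx 0 1 0 0)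
          (unlift ord0 i)).
split.
  split=> [x y [i ->] [j ->]|x [i ->]].
    case: (unliftP ord0 i) => [i' _|_]; case: (unliftP ord0 j) => [j' _|_] /=;
      rewrite -!mulmxE !mulmx_block opp_block_mx ?(mulmx0, mul0mx, addr0, add0r);
      rewrite ?(mulmxN, mulNmx, opprK, oppr0, mul1mx, mulmx1) //.
    have E : th i' *m th j' = - (th j' *m th i') by apply: thC; [exists i'|exists j'].
    by rewrite E.
  case: (unliftP ord0 i) => [i' _|_] /=; rewrite -mulmxE mulmx_block.
    have E : th i' *m th i' = 0 by apply: thK; exists i'.
    by rewrite !(mulmx0, mul0mx, addr0, add0r, mulmxN, mulNmx) opprK E block_mx0.
  by rewrite !(mulmx0, mul0mx, addr0) block_mx0.
rewrite big_ord_recl unlift_none /=.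
under eq_bigr do rewrite liftK /=.
have -> : \prod_(i < N) block_mx (th i) 0 0 (- th i) =
    block_mx (\prod_i th i) 0 0 (\prod_i - th i).
  clear thC thK th0; elim: N th => [|N IH] th; first by rewrite !big_ord0 -scalar_mx_block.
  rewrite !big_ord_recl IH -!mulmxE mulmx_block.
  by rewrite !(mulmx0, mul0mx, addr0, add0r).
rewrite -mulmxE mulmx_block !(mulmx0, mul0mx, mul1mx, addr0, add0r) prodrN.
apply/eqP => /(congr1 (@ursubmx _ k k k k)); rewrite block_mxKur.
rewrite -[0 in RHS]block_mx0 block_mxKur -signr_odd mulr_sign => E.
case/eqP: th0; case: odd E => //.
by move/eqP; rewrite oppr_eq0 => /eqP.
Qed.

(** * The Amitsur-Levitzki theorem *)

Section CharPolyTrace.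
Variable R : comNzRingType.

Lemma deriv_prod_ord n (p : 'I_n -> {poly R}) :
  (\prod_i p i)^`() = \sum_i (p i)^`() * \prod_(j | j != i) p j.
Proof.
elim: n p => [|n IH] p; first by rewrite !big_ord0 derivC.
rewrite big_ord_recl derivM IH [RHS]big_ord_recl; congr (_ * _ + _).
  by rewrite [RHS]big_mkcond big_ord_recl /= mul1r.
rewrite mulr_sumr; apply: eq_bigr => i _.
rewrite mulrCA; congr (_ * _).
rewrite [RHS]big_mkcond big_ord_recl /= [X in _ * X = _]big_mkcond /=.
by congr (_ * _).
Qed.

(** In [D i], row [i] of the characteristic matrix is replaced by its derivative, a unit row. The
    determinant of [D i] is thus both a diagonal entry of the adjugate and one term of the product
    rule. *)
Lemma deriv_char_poly n (A : 'M[R]_n) :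
  (char_poly A)^`() = \tr (\adj (char_poly_mx A)).
Proof.
rewrite /char_poly /mxtrace; set M := char_poly_mx A.
pose D i := \matrix_(j, k) if j == i then (k == i)%:R else M j k.
have DE i : \adj M i i = \det (D i).
  rewrite mxE (expand_det_row _ i) (bigD1 i) //= big1 ?addr0 => [|k /negbTE ki].
    rewrite mxE !eqxx mul1r /cofactor; congr (_ * \det _).
    by apply/matrixP => j k; rewrite !mxE [lift i j == i]eq_sym (negbTE (neq_lift i j)).
  by rewrite mxE eqxx ki mul0r.
under [RHS]eq_bigr do rewrite DE.
rewrite /determinant exchange_big /= raddf_sum; apply: eq_bigr => s _ /=.
rewrite -mulr_sumr.
transitivity ((-1) ^+ s * (\prod_i M i (s i))^`()).
  by rewrite !mulr_sign; case: ifP; rewrite ?derivN.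
rewrite deriv_prod_ord; congr (_ * _); apply: eq_bigr => i _.
rewrite [RHS](bigD1 i) //= [D i i _]mxE eqxx; congr (_ * _).
  rewrite !mxE eq_sym; case: eqP => _; rewrite ?(mulr1n, mulr0n) derivB.
    by rewrite derivX derivC subr0.
  by rewrite !derivC subr0.
by apply: eq_bigr => j /negbTE ji; rewrite [D i j _]mxE ji.
Qed.

(* Faddeev-LeVerrier: with vanishing traces, the coefficient of X^k in the
   adjugate of X - c is c^(n-1-k). *)
Lemma trace_nilpotent n (c : 'M[R]_n) :
    (forall j (x : R), (0 < j)%N -> x *+ j = 0 -> x = 0) ->
    (forall j, (0 < j)%N -> \tr (c ^+ j) = 0) ->
  c ^+ n = 0.
Proof.
move=> R_tf tr0; set p := char_poly c.
have [M [ME trM]] : exists M, char_poly_mx c *m M = p%:M /\ \tr M = p^`().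
  by exists (\adj (char_poly_mx c)); rewrite mul_mx_adj -deriv_char_poly.
(* The coefficient of [X ^ k] in the adjugate; [ME] turns into a recursion for [B] and [trM] into
   its traces. *)
pose B k : 'M[R]_n := \matrix_(i, j) (M i j)`_k.
have coefB k i j : (p`_k)%:M i j = (if k is k'.+1 then B k' i j else 0) - (c *m B k) i j.
  have /matrixP/(_ i j)/(congr1 (fun q : {poly R} => q`_k)) := ME.
  rewrite !mxE coefMn => <-; rewrite coef_sum.
  under eq_bigr => l _ do rewrite !mxE mulrBl coefB coefCM mulrnAl coefMn coefXM.
  rewrite sumrB; congr (_ - _); last by apply: eq_bigr => l _; rewrite mxE.
  rewrite (bigD1 i) //= eqxx big1 => [|l /negbTE li]; last by rewrite [i == l]eq_sym li.
  by rewrite addr0 mulr1n; case: (k) => //= k'; rewrite mxE.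
have recB k : B k = c *m B k.+1 + (p`_(k.+1))%:M.
  by apply/matrixP => i j; rewrite [RHS]mxE coefB addrC subrK.
have rec0 : c *m B 0 + (p`_0)%:M = 0.
  by apply/matrixP => i j; rewrite [LHS]mxE coefB addrC subrK mxE.
have trB k : \tr (B k) = p`_k.+1 *+ k.+1.
  rewrite -coef_deriv -trM /mxtrace coef_sum.
  by apply: eq_bigr => i _; rewrite mxE.
have p_big k : (n < k)%N -> p`_k = 0.
  by move=> nk; rewrite nth_default // size_char_poly.
have B_big k : (n <= k)%N -> B k = 0.
  have [K BK] : exists K, forall k, (K <= k)%N -> B k = 0.
    exists (\max_i \max_j size (M i j)) => k' Kk.
    apply/matrixP => i j; rewrite !mxE nth_default //; apply: leq_trans Kk.
    by apply: leq_trans (leq_bigmax i); apply: (leq_bigmax (F := fun j => size _) j).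
  elim: {k}(K - k)%N {-2}k (leqnn (K - k)) => [|d IH] k dk nk.
    by apply: BK; rewrite -subn_eq0 -leqn0.
  have [/BK//|kK] := leqP K k.
  rewrite recB IH ?mulmx0 ?add0r ?p_big ?raddf0 //; last exact: leqW.
  by rewrite subnS -ltnS prednK // subn_gt0.
have p_n : p`_n = 1.
  by have /monicP := char_poly_monic c; rewrite /lead_coef size_char_poly.
have B_pow j : forall k, n = (k + j).+1 -> B k = c ^+ j.
  elim: j => [|j IH] k nE.
    rewrite addn0 in nE.
    by rewrite recB -nE p_n B_big // mulmx0 add0r expr0.
  have E := recB k; rewrite (IH k.+1) ?addSnnS // mulmxE -exprS in E.
  suff p0 : p`_k.+1 = 0 by rewrite E p0 raddf0 addr0.
  apply: (R_tf j.+1) => //.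
  (* The trace of [B k] is [k + 1] times the coefficient by [trB], and [n] times it by the recursion
     and [tr0]; here [n] is [k + j + 2], so the difference is [j + 1] times the coefficient. *)
  have := trB k; rewrite E raddfD /= tr0 // add0r mxtrace_scalar.
  rewrite {1}nE -addSn mulrnDr => /(canRL (addKr _)).
  by rewrite addNr.
case: (posnP n) => [n0|n_gt0]; first by clear -n0; subst n; apply/matrixP => -[].
have nE : n = (0 + n.-1).+1 by rewrite add0n prednK.
have B0 := B_pow _ _ nE.
move: rec0; rewrite B0 mulmxE -exprS prednK // => E.
suff p0 : p`_0 = 0 by rewrite p0 raddf0 addr0 in E.
apply: (R_tf n) => //.
by have /(congr1 mxtrace) := E; rewrite raddf0 raddfD /= tr0 // add0r mxtrace_scalar.
Qed.

End CharPolyTrace.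

Section SignCommutation.
Variables (L : pzRingType) (O : L -> Prop).

(** [s] records the parity of the degree of the entries, when the elements of [O] have degree 1. *)
Definition sgn_comm (s : bool) m n (M : 'M[L]_(m, n)) : Prop :=
  forall t i j, O t -> t * M i j = (-1) ^+ s * (M i j * t).

Lemma sgn_comm_mul s s' m n p (M : 'M_(m, n)) (M' : 'M_(n, p)) :
  sgn_comm s M -> sgn_comm s' M' -> sgn_comm (s (+) s') (M *m M').
Proof.
move=> cM cM' t i j Ot; rewrite mxE mulr_sumr mulr_suml mulr_sumr.
apply: eq_bigr => k _; rewrite mulrA cM // -!mulrA cM' // signr_addb.
by rewrite !mulrA; congr (_ * _ * _); rewrite -!mulrA; congr (_ * _); apply: commr_sign.
Qed.

Lemma sgn_comm_exp n (M : 'M_n) q : sgn_comm true M -> sgn_comm (odd q) (M ^+ q).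
Proof.
move=> cM; elim: q => [|q IH] /=; last by rewrite exprS -mulmxE; apply: (sgn_comm_mul cM).
by move=> t i j _; rewrite mul1r !mxE; case: eqP; rewrite ?(mulr1, mul1r, mulr0, mul0r).
Qed.

Lemma sgn_comm_odd m n (M : 'M_(m, n)) :
  anticommuting O -> (forall i j, O (M i j)) -> sgn_comm true M.
Proof. by case=> OC _ OM t i j Ot; rewrite mulN1r; apply: OC. Qed.

End SignCommutation.

Section Bicommutant.
Variables (L : nzRingType) (S : L -> Prop).

(** The double centraliser stands in for the subring generated by [S]: it contains [S], and is
    commutative when the elements of [S] commute. *)
Definition bicommutant : {pred L} :=
  fun x => `[< forall y, (forall s, S s -> s * y = y * s) -> x * y = y * x >].

Lemma bicommutant_subring : GRing.subring_closed bicommutant.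
Proof.
split=> [|x y /asboolP Px /asboolP Py|x y /asboolP Px /asboolP Py];
  apply/asboolP => z Sz.
- by rewrite mulr1 mul1r.
- by rewrite mulrBl mulrBr Px // Py.
- by rewrite -mulrA Py // mulrA Px // mulrA.
Qed.

HB.instance Definition _ := GRing.isSubringClosed.Build L bicommutant bicommutant_subring.

Record bicomm_type := Bicomm { bicomm_val : L; _ : bicomm_val \in bicommutant }.

HB.instance Definition _ := [isSub for bicomm_val].
HB.instance Definition _ := [Choice of bicomm_type by <:].
HB.instance Definition _ := [SubChoice_isSubNzRing of bicomm_type by <:].

Hypothesis SC : forall x y, S x -> S y -> x * y = y * x.

(* Commutativity depends on [SC], hence an alias which mentions it. *)
Definition bicomm := let _ := SC in bicomm_type.

HB.instance Definition _ := GRing.SubNzRing.on bicomm.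

Lemma bicomm_mulC : commutative (@GRing.mul bicomm).
Proof.
move=> x y; apply: val_inj; rewrite !rmorphM /=.
move: (valP x) (valP y) => /asboolP xP /asboolP yP.
by apply: xP => s Ss; apply/esym/yP => t St; apply: SC.
Qed.

HB.instance Definition _ := GRing.PzRing_hasCommutativeMul.Build bicomm bicomm_mulC.

Lemma bicomm_lift x : S x -> exists y : bicomm, val y = x.
Proof.
move=> Sx; have xP : x \in bicommutant by apply/asboolP => y; apply.
by exists (Sub x xP : bicomm); rewrite SubK.
Qed.

End Bicommutant.

(** This makes characteristic polynomials available for a matrix with commuting entries in a
    noncommutative ring. *)
Lemma commuting_subring (L : nzRingType) (S : L -> Prop) :
    (forall x y, S x -> S y -> x * y = y * x) ->
  exists (R : comNzRingType) (f : {rmorphism R -> L}),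
    injective f /\ forall x, S x -> exists y, f y = x.
Proof.
move=> SC; exists (bicomm SC), \val; split; first exact: val_inj.
by move=> x Sx; apply: bicomm_lift.
Qed.

Definition entry (L : Type) m n (M : 'M[L]_(m, n)) (x : L) : Prop :=
  exists i j, x = M i j.

(* Rosset: the entries of a ^+ 2 commute, and its powers have trace zero. *)
Lemma rosset (L : nzRingType) n (a : 'M[L]_n) :
    (forall j (x : L), (0 < j)%N -> x *+ j = 0 -> x = 0) ->
    anticommuting (entry a) -> a ^+ (2 * n) = 0.
Proof.
move=> L_tf a_anti.
have a_odd : sgn_comm (entry a) true a by apply: sgn_comm_odd => // i j; exists i, j.
have a2C x y : entry (a ^+ 2) x -> entry (a ^+ 2) y -> x * y = y * x.
  move=> [i [j ->]] [i' [j' ->]].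
  have C t : entry a t -> t * (a ^+ 2) i' j' = (a ^+ 2) i' j' * t.
    by move=> /(sgn_comm_exp 2 a_odd i' j') ->; rewrite mul1r.
  move: (_ i' j') C => z C; rewrite expr2 -mulmxE mxE mulr_suml mulr_sumr.
  apply: eq_bigr => k _; rewrite -mulrA C; last by exists k, j.
  by rewrite mulrA C; [rewrite mulrA | exists i, k].
have [R [f [f_inj f_lift]]] := commuting_subring a2C.
have [c cE] : exists c, map_mx f c = a ^+ 2.
  have D (ij : 'I_n * 'I_n) : exists y, f y = (a ^+ 2) ij.1 ij.2.
    by apply: f_lift; exists ij.1, ij.2.
  have [g gE] := choice D.
  exists (\matrix_(i, j) g (i, j)); apply/matrixP => i j.
  by rewrite [LHS]mxE [X in f X]mxE gE.
have cX j : map_mx f (c ^+ j) = a ^+ (2 * j).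
  by rewrite exprM -cE; apply: (rmorphXn (map_mx f)).
rewrite -cX trace_nilpotent ?map_mx0 // => [j x j_gt0 xj|[//|j] _].
  by apply: f_inj; rewrite rmorph0; apply: (L_tf j) => //; rewrite -rmorphMn xj rmorph0.
(* An even power is [a] times an odd power. Exchanging these factors under the trace changes the
   sign, because their entries anticommute; so twice the trace is zero. *)
apply: f_inj; rewrite -trace_map_mx cX rmorph0; apply: (L_tf 2) => //.
have b_odd : sgn_comm (entry a) true (a ^+ (2 * j).+1).
  by have := sgn_comm_exp (2 * j).+1 a_odd; rewrite /= mul2n odd_double.
rewrite mulnS add2n mulr2n; move: (_.+1) b_odd => p b_odd.
rewrite {1}exprS exprSr -!mulmxE /mxtrace -big_split /=.
transitivity (\sum_i \sum_k (a i k * (a ^+ p) k i + (a ^+ p) i k * a k i)).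
  by apply: eq_bigr => i _; rewrite !mxE -big_split.
under eq_bigr do rewrite big_split.
rewrite big_split /= [X in _ + X]exchange_big -big_split big1 //= => i _.
rewrite -big_split big1 //= => k _.
by rewrite b_odd ?mulN1r ?addNr //; exists i, k.
Qed.

Lemma standard_poly_rmorph (R R' : pzRingType) (f : {rmorphism R -> R'}) t (r : 'I_t -> R) :
  f (standard_poly r) = standard_poly (fun i => f (r i)).
Proof.
rewrite rmorph_sum; apply: eq_bigr => s _.
by rewrite rmorphM rmorph_sign rmorph_prod.
Qed.

Section Grassmann.
Variables (F : fieldType) (k N : nat) (th : 'I_N -> 'M[F]_k).

(** The sum of the [r l] times [th l], written with entries in the span of the [th l], so that
    results about anticommuting entries apply. *)
Definition grassmann m n (r : 'I_N -> 'M[F]_(m, n)) : 'M['M[F]_k]_(m, n) :=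
  \matrix_(i, j) \sum_l r l i j *: th l.

Definition odd_span (x : 'M[F]_k) : Prop := exists c, x = \sum_l c l *: th l.

Lemma grassmann_entry m n (r : 'I_N -> 'M_(m, n)) i j : odd_span (grassmann r i j).
Proof. by exists (fun l => r l i j); rewrite mxE. Qed.

Lemma grassmannE n (r : 'I_N -> 'M_n) :
  grassmann r = \sum_l map_mx (@scalar_mx F k) (r l) * (th l)%:M.
Proof.
apply/matrixP => i j; rewrite mxE summxE; apply: eq_bigr => l _.
rewrite -mulmxE mxE (bigD1 j) //= big1 => [|j' /negbTE j'j].
  by rewrite !mxE eqxx mulr1n addr0 -mulmxE mul_scalar_mx.
by rewrite !mxE j'j mulr0n mulr0.
Qed.

Lemma grassmann_mulmx m n p (K : 'M_(m, n)) (r : 'I_N -> 'M_(n, p)) :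
  grassmann (fun l => K *m r l) = map_mx (@scalar_mx F k) K *m grassmann r.
Proof.
apply/matrixP => i j; rewrite !mxE.
under [RHS]eq_bigr => a _ do rewrite !mxE mulr_sumr.
rewrite exchange_big /=; apply: eq_bigr => l _; rewrite mxE scaler_suml.
by apply: eq_bigr => a _; rewrite -mulmxE mul_scalar_mx scalerA.
Qed.

Lemma grassmann_mulmxr m n p (K : 'M_(n, p)) (r : 'I_N -> 'M_(m, n)) :
  grassmann (fun l => r l *m K) = grassmann r *m map_mx (@scalar_mx F k) K.
Proof.
apply/matrixP => i j; rewrite !mxE.
under [RHS]eq_bigr => a _ do rewrite !mxE mulr_suml.
rewrite exchange_big /=; apply: eq_bigr => l _; rewrite mxE scaler_suml.
by apply: eq_bigr => a _; rewrite -mulmxE mul_mx_scalar scalerA mulrC.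
Qed.

Hypothesis th_anti : anticommuting (fun x => exists i, x = th i).

Let thC i j : th i * th j = - (th j * th i).
Proof. by apply: th_anti.1; [exists i | exists j]. Qed.

Let thK i : th i * th i = 0.
Proof. by apply: th_anti.2; exists i. Qed.

Lemma odd_span_anti : anticommuting odd_span.
Proof.
have C (c d : 'I_N -> F) (s s' : seq 'I_N) :
    (\sum_(i <- s) c i *: th i) * (\sum_(i <- s') d i *: th i) =
    - ((\sum_(i <- s') d i *: th i) * (\sum_(i <- s) c i *: th i)).
  rewrite [X in _ = - X]mulr_sumr mulr_suml -sumrN; apply: eq_bigr => i _.
  rewrite mulr_sumr mulr_suml -sumrN; apply: eq_bigr => j _.
  rewrite -!mulmxE -!scalemxAl -!scalemxAr !mulmxE thC !scalerN !scalerA.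
  by rewrite [d j * _]mulrC.
split=> [_ _ [c ->] [d ->]|_ [c ->]]; first exact: C.
(* The square is computed term by term: the cross terms cancel by [C], which in characteristic 2
   says nothing about squares. *)
elim: (index_enum _) => [|i s IH]; first by rewrite !big_nil mul0r.
rewrite !big_cons mulrDl !mulrDr IH addr0.
have := C c c [:: i] s; rewrite !big_cons !big_nil !addr0 => ->.
by rewrite addrNK -!mulmxE -!scalemxAl -!scalemxAr !mulmxE thK !scaler0.
Qed.

Let scal_anti n : anticommuting (fun x : 'M['M[F]_k]_n => exists i, x = (th i)%:M).
Proof.
split=> [_ _ [i ->] [j ->]|_ [i ->]]; rewrite -!mulmxE -!scalar_mxM.
  by rewrite thC raddfN.
by rewrite thK raddf0.
Qed.

Let scal_comm n (M : 'M[F]_n) i :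
  GRing.comm (map_mx (@scalar_mx F k) M) (th i)%:M.
Proof.
apply/matrixP => a b; rewrite -!mulmxE !mxE (bigD1 b) //= big1 => [|c /negbTE cb].
  rewrite (bigD1 a) //= big1 => [|c /negbTE ca].
    by rewrite !mxE !eqxx !mulr1n !addr0 -!mulmxE scalar_mxC.
  by rewrite !mxE eq_sym ca mul0r.
by rewrite !mxE cb mulr0.
Qed.

Lemma grassmann_exp_eq0 n p (r : 'I_N -> 'M_n) :
    (forall g : 'I_p -> 'I_N, injective g -> standard_poly (fun i => r (g i)) = 0) ->
  grassmann r ^+ p = 0.
Proof.
move=> r0; rewrite grassmannE; apply: expr_sum_eq0 => [|i j|g g_inj];
  [exact: scal_anti|exact: scal_comm|].
transitivity (map_mx (@scalar_mx F k) (standard_poly (fun i => r (g i)))).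
  by rewrite (standard_poly_rmorph (map_mx _)).
by rewrite r0 // map_mx0.
Qed.

Lemma grassmann_exp n (r : 'I_N -> 'M_n) :
  grassmann r ^+ N =
  map_mx (@scalar_mx F k) (standard_poly r) * (\prod_i th i)%:M.
Proof.
rewrite grassmannE expr_sum_standard; [|exact: scal_anti|by move=> i j; apply: scal_comm].
congr (_ * _).
  by rewrite (standard_poly_rmorph (map_mx _)).
by rewrite -(rmorph_prod (@scalar_mx _ n)).
Qed.

End Grassmann.

(** Since the product of all generators is nonzero, the standard polynomial can be read off from the
    [N]-th power. The size [k.+1] makes the coefficient ring nonzero. *)
Lemma standard_poly_eq0 (F : fieldType) N n (r : 'I_N -> 'M[F]_n) :
    (forall k (th : 'I_N -> 'M[F]_k.+1), anticommuting (fun x => exists i, x = th i) ->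
       grassmann th r ^+ N = 0) ->
  standard_poly r = 0.
Proof.
move=> r0; have [[|k] [th [th_anti th0]]] := grassmann_generators F N.
  by case/eqP: th0; apply/matrixP => -[].
apply/matrixP => i j; have /matrixP/(_ i j) := r0 k th th_anti.
rewrite grassmann_exp // -mulmxE mxE (bigD1 j) //= [X in _ + X]big1 => [|c /negbTE cj].
  rewrite !mxE eqxx mulr1n addr0 -mulmxE mul_scalar_mx => /eqP.
  by rewrite scaler_eq0 (negbTE th0) orbF => /eqP.
by rewrite !mxE cj mulr0.
Qed.

(** Rational coefficients provide the absence of torsion required by [rosset]. *)
Lemma amitsur_levitzki_rat n (r : 'I_(2 * n) -> 'M[rat]_n) : standard_poly r = 0.
Proof.
apply: standard_poly_eq0 => k th th_anti; apply: rosset.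
  move=> j x j_gt0 /matrixP xj; apply/matrixP => a b; have := xj a b.
  by rewrite !mxE mulmxnE => /eqP; rewrite Num.Theory.mulrn_eq0 eqn0Ngt j_gt0 => /eqP.
have [C K] := odd_span_anti th_anti.
split=> [_ _ [i [j ->]] [i' [j' ->]]|_ [i [j ->]]].
  by apply: C; apply: grassmann_entry.
by apply: K; apply: grassmann_entry.
Qed.

(** Matrix units are defined over [int], so the identity descends from [rat] to [int] and then maps
    to any ring. *)
Lemma delta_standard (T : pzRingType) n t (g : 'I_t -> 'I_n * 'I_n) :
  t = (2 * n)%N ->
  standard_poly (fun i => delta_mx (g i).1 (g i).2 : 'M[T]_n) = 0.
Proof.
move=> tE; move: g; rewrite tE => g.
pose d (R : pzRingType) i : 'M[R]_n := delta_mx (g i).1 (g i).2.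
have dE (R R' : pzRingType) (f : {rmorphism R -> R'}) :
    map_mx f (standard_poly (d R)) = standard_poly (d R').
  rewrite (standard_poly_rmorph (map_mx f)) /standard_poly.
  apply: eq_bigr => s _; congr (_ * _); apply: eq_bigr => i _.
  exact: map_delta_mx.
have d0 : standard_poly (d int) = 0.
  apply/matrixP => i j; have /matrixP/(_ i j) := dE _ _ (@intmul rat 1).
  by rewrite amitsur_levitzki_rat !mxE => /eqP; rewrite intr_eq0 => /eqP.
by have := dE _ _ (@intmul T 1); rewrite d0 map_mx0 => /esym.
Qed.

(* Only the matrix units enter the left factors, so that the integral case
   suffices. *)
Lemma amitsur_levitzki (T : pzRingType) n (a : 'M[T]_n) :
  anticommuting (entry a) -> a ^+ (2 * n) = 0.
Proof.
move=> [aC aK].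
have -> : a = \sum_(p : 'I_n * 'I_n) delta_mx p.1 p.2 * (a p.1 p.2)%:M.
  rewrite -(pair_bigA _ (fun i j => delta_mx i j * (a i j)%:M)) /=.
  apply/matrixP => i j; rewrite summxE (bigD1 i) //= summxE (bigD1 j) //=.
  have E i' j' : (delta_mx i' j' * (a i' j')%:M) i j =
      if (i == i') && (j == j') then a i' j' else 0.
    rewrite -mulmxE mxE (bigD1 j) //= big1 => [|k /negbTE kj]; last by rewrite !mxE kj mulr0.
    by rewrite !mxE eqxx mulr1n addr0; case: ifP; rewrite ?mul1r ?mul0r.
  rewrite E !eqxx /= [X in _ + X + _]big1 => [|j' /negbTE j'j]; last first.
    by rewrite E [j == _]eq_sym j'j andbF.
  rewrite big1 ?addr0 // => i' /negbTE i'i; rewrite summxE big1 // => j' _.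
  by rewrite E [i == _]eq_sym i'i.
apply: expr_sum_eq0 => [|p q|g g_inj]; last exact: delta_standard.
  split=> [_ _ [p ->] [q ->]|_ [p ->]]; rewrite -!mulmxE -!scalar_mxM.
    by rewrite aC ?raddfN //; [exists p.1, p.2|exists q.1, q.2].
  by rewrite aK ?raddf0 //; exists p.1, p.2.
apply/matrixP => i j; rewrite -!mulmxE !mxE (bigD1 j) //= big1 => [|c /negbTE cj].
  rewrite (bigD1 i) //= big1 => [|c /negbTE ci].
    rewrite !mxE !eqxx !mulr1n !addr0.
    by case: (_ && _); rewrite ?mulr1 ?mul1r ?mulr0 ?mul0r.
  by rewrite !mxE eq_sym ci mul0r.
by rewrite !mxE cj mulr0.
Qed.

Lemma anticomm_entry (F : fieldType) k N (th : 'I_N -> 'M[F]_k) m n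
    (M : 'M['M[F]_k]_(m, n)) :
    anticommuting (fun x => exists i, x = th i) ->
    (forall i j, odd_span th (M i j)) -> anticommuting (entry M).
Proof.
move=> /odd_span_anti[C K] OM.
by split=> [_ _ [i [j ->]] [i' [j' ->]]|_ [i [j ->]]]; [apply: C|apply: K].
Qed.

(** * Standard identities of matrix algebras *)

Section Satisfies.
Variable F : fieldType.

Definition sat n (A : 'M[F]_n -> Prop) (p : nat) : Prop :=
  forall r : 'I_p -> 'M[F]_n, (forall i, A (r i)) -> standard_poly r = 0.

Lemma sat_grassmann n (A : 'M[F]_n -> Prop) p k N (th : 'I_N -> 'M[F]_k) r :
    anticommuting (fun x => exists i, x = th i) ->
    sat A p -> (forall i, A (r i)) -> grassmann th r ^+ p = 0.
Proof. by move=> th_anti satA Ar; apply: grassmann_exp_eq0 => // g _; apply: satA. Qed.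

Lemma leq_sat n (A : 'M[F]_n -> Prop) p q : (p <= q)%N -> sat A p -> sat A q.
Proof.
move=> pq satA r Ar; apply: standard_poly_eq0 => k th th_anti.
by rewrite -[X in _ ^+ X](subnK pq) exprD (sat_grassmann th_anti satA) // mulr0.
Qed.

Lemma sat_matrix n (A : 'M[F]_n -> Prop) p : (2 * n <= p)%N -> sat A p.
Proof.
move=> np; apply: (leq_sat np) => r Ar; apply: standard_poly_eq0 => k th th_anti.
apply: amitsur_levitzki; apply: (anticomm_entry th_anti); exact: grassmann_entry.
Qed.

Lemma standard_intertwine m n p (K : 'M[F]_(m, n)) (r : 'I_p -> 'M_n) r' :
  (forall i, K *m r i = r' i *m K) -> K *m standard_poly r = standard_poly r' *m K.
Proof.
move=> Kr; rewrite mulmx_sumr mulmx_suml; apply: eq_bigr => s _.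
have E (h : 'I_p -> 'I_p) (t : seq 'I_p) :
    K *m (\prod_(i <- t) r (h i)) = (\prod_(i <- t) r' (h i)) *m K.
  elim: t => [|i t IH]; first by rewrite !big_nil mulmx1 mul1mx.
  by rewrite !big_cons -!mulmxE mulmxA Kr -mulmxA IH mulmxA.
by rewrite !mulr_sign; case: (odd_perm s); rewrite ?mulmxN ?mulNmx E.
Qed.

(** The row space of [H] is a submodule; in the basis [row_base H] the action is by matrices of size
    [\rank H], to which Amitsur-Levitzki applies. *)
Lemma standard_invariant n q p (H : 'M[F]_(q, n)) (r : 'I_p -> 'M_n) :
    (2 * \rank H <= p)%N -> (forall i, (H *m r i <= H)%MS) ->
  H *m standard_poly r = 0.
Proof.
move=> Hp Hr; have E i : row_base H *m r i =
    (row_base H *m r i *m pinvmx (row_base H)) *m row_base H.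
  by rewrite mulmxKpV // eq_row_base (eqmxMr _ (eq_row_base H)).
have := standard_intertwine E; rewrite (sat_matrix (A := fun => True) Hp) // mul0mx => E0.
have /submxP[D ->] : (H <= row_base H)%MS by rewrite eq_row_base.
by rewrite -mulmxA E0 mulmx0.
Qed.

(* [H] is the inclusion of a submodule, [C] the projection on the quotient. *)
Lemma sat_extension n d s p q (A : 'M[F]_n -> Prop)
    (Aq : 'M_d -> Prop) (As : 'M_s -> Prop)
    (H : 'M[F]_(s, n)) (C : 'M[F]_(n, d)) H' C' :
    C *m C' + H' *m H = 1%:M ->
    (forall r, A r -> exists2 b, Aq b & r *m C = C *m b) ->
    (forall r, A r -> exists2 b, As b & H *m r = b *m H) ->
  sat Aq p -> sat As q -> sat A (p + q).
Proof.
move=> CH Cr Hr satq sats r Ar; apply: standard_poly_eq0 => k th th_anti.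
have Cri i : exists b, Aq b /\ r i *m C = C *m b by have [b] := Cr _ (Ar i); exists b.
have Hri i : exists b, As b /\ H *m r i = b *m H by have [b] := Hr _ (Ar i); exists b.
have [f fE] := choice Cri; have [g gE] := choice Hri.
set a := grassmann th r; pose i m1 m2 := map_mx (m := m1) (n := m2) (@scalar_mx F k.+1).
have aC j : a ^+ j *m i _ _ C = i _ _ C *m grassmann th f ^+ j.
  elim: j => [|j IH]; first by rewrite mul1mx mulmx1.
  rewrite !exprS -!mulmxE -mulmxA IH mulmxA.
  have -> : a *m i _ _ C = i _ _ C *m grassmann th f.
    rewrite -grassmann_mulmx -grassmann_mulmxr; congr grassmann.
    by apply: funext => l; case: (fE l).
  by rewrite -mulmxA.
have Ha j : i _ _ H *m a ^+ j = grassmann th g ^+ j *m i _ _ H.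
  elim: j => [|j IH]; first by rewrite mul1mx mulmx1.
  rewrite !exprSr -!mulmxE mulmxA IH -mulmxA.
  have -> : i _ _ H *m a = grassmann th g *m i _ _ H.
    rewrite -grassmann_mulmx -grassmann_mulmxr; congr grassmann.
    by apply: funext => l; case: (gE l).
  by rewrite mulmxA.
(* The identity, split as in [CH], is inserted between [a ^+ p] and [a ^+ q]: one summand dies on
   the quotient, the other on the submodule. *)
rewrite exprD -mulmxE -[a ^+ p]mulmx1.
have <- : i _ _ C *m i _ _ C' + i _ _ H' *m i _ _ H = 1%:M.
  by rewrite -!map_mxM -map_mxD CH map_mx1.
rewrite mulmxDr !mulmxA aC (sat_grassmann th_anti satq) => [|l]; last by case: (fE l).
rewrite mulmx0 mul0mx add0r -mulmxA Ha (sat_grassmann th_anti sats) => [|l];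
  last by case: (gE l).
by rewrite mul0mx mulmx0.
Qed.

End Satisfies.

(** * Isomorphic first and last diagonal blocks *)

Section LinkedBlocks.
Variable L : pzRingType.

(** The upper right block of a power of [block_mx a u 0 c]; the index [p] is the step at which a
    path passes through [u]. *)
Definition path_sum m n (a : 'M[L]_m) (u : 'M_(m, n)) (c : 'M_n) (k : nat) :=
  \sum_(p < k) a ^+ p *m u *m c ^+ (k.-1 - p).

Lemma path_sumS m n (a : 'M_m) (u : 'M_(m, n)) (c : 'M_n) k :
  path_sum a u c k.+1 = a *m path_sum a u c k + u *m c ^+ k.
Proof.
rewrite /path_sum big_ord_recl /= subn0 mul1mx addrC; congr (_ + _).
rewrite mulmx_sumr; apply: eq_bigr => p _.
by rewrite /bump /= exprS -!mulmxE -!mulmxA; do 3!congr (_ *m _); congr (_ ^+ _); lia.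
Qed.

Lemma block_upper_exp m n (a : 'M_m) (u : 'M_(m, n)) (c : 'M_n) k :
  block_mx a u 0 c ^+ k = block_mx (a ^+ k) (path_sum a u c k) 0 (c ^+ k) :> 'M[L]_(m + n).
Proof.
elim: k => [|k IH]; first by rewrite /path_sum big_ord0 -scalar_mx_block.
rewrite exprS IH -mulmxE mulmx_block !mulmx0 !mul0mx !addr0 !add0r !mulmxE -!exprS.
by rewrite path_sumS.
Qed.

(** The exponents of [a] and [c] add up to [p + q], and nilpotency bounds them by [p] and [q]; in
    [path_sum_two] there is a slack of one. *)
Lemma path_sum_one m n (a : 'M_m) (u : 'M_(m, n)) (c : 'M_n) p q :
    a ^+ p.+1 = 0 -> c ^+ q.+1 = 0 ->
  path_sum a u c (p + q).+1 = a ^+ p *m u *m c ^+ q.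
Proof.
move=> ap cq; have pP : (p < (p + q).+1)%N by lia.
rewrite /path_sum (bigD1 (Ordinal pP)) //= big1 => [|i /negP ip].
  by rewrite addr0; congr (_ *m _); congr (_ ^+ _); lia.
have [pi|ip'] := ltnP p i.
  by rewrite -(subnK pi) exprD ap mulr0 !mul0mx.
have iq : (q < p + q - i)%N.
  by move: ip; rewrite -val_eqE /=; lia.
by rewrite -(subnK iq) exprD cq mulr0 mulmx0.
Qed.

Lemma path_sum_two m n (a : 'M_m) (u : 'M_(m, n)) (c : 'M_n) p q :
    a ^+ p.+2 = 0 -> c ^+ q.+2 = 0 ->
  path_sum a u c (p + q).+2 = a ^+ p.+1 *m u *m c ^+ q + a ^+ p *m u *m c ^+ q.+1.
Proof.
move=> ap cq; have pP : (p < (p + q).+2)%N by lia.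
have p1P : (p.+1 < (p + q).+2)%N by lia.
rewrite /path_sum (bigD1 (Ordinal p1P)) //= (bigD1 (Ordinal pP)) /=; last first.
  by rewrite -val_eqE /=; lia.
rewrite big1 => [|i /andP[ip1 ip]].
  by rewrite addr0; congr (_ + _); congr (_ *m _); congr (_ ^+ _); lia.
rewrite -!val_eqE /= in ip ip1.
have [pi|ip'] := ltnP p.+1 i.
  by rewrite -(subnK pi) exprD ap mulr0 !mul0mx.
have iq : (q.+1 < (p + q).+1 - i)%N by lia.
by rewrite -(subnK iq) exprD cq mulr0 mulmx0.
Qed.

Let tri_entry (x y z : L) : 'M[L]_(1 + 1) := block_mx x%:M y%:M 0 z%:M.

(** Storing [a], [w], [c] in entries that are 2 x 2 matrices keeps the outer size [l], so that
    Amitsur-Levitzki gives the exponent [2 * l] rather than [4 * l]. *)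
Let tri l (a w c : 'M[L]_l) : 'M['M[L]_(1 + 1)]_l :=
  \matrix_(i, j) tri_entry (a i j) (w i j) (c i j).

Let tri_entryM x y z x' y' z' :
  tri_entry x y z * tri_entry x' y' z' = tri_entry (x * x') (x * y' + y * z') (z * z').
Proof.
rewrite -mulmxE mulmx_block !mulmx0 !mul0mx !addr0 !add0r -!scalar_mxM.
by rewrite -raddfD.
Qed.

Let tri_entryD x y z x' y' z' :
  tri_entry x y z + tri_entry x' y' z' = tri_entry (x + x') (y + y') (z + z').
Proof. by rewrite /tri_entry add_block_mx addr0 -!raddfD. Qed.

Let triM l (a w c a' w' c' : 'M_l) :
  tri a w c * tri a' w' c' = tri (a *m a') (a *m w' + w *m c') (c *m c').
Proof.
apply/matrixP => i j; rewrite -mulmxE !mxE -big_split /=.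
under eq_bigr do rewrite !mxE tri_entryM.
elim: (index_enum _) => [|k s IH].
  by rewrite !big_nil /tri_entry !raddf0 block_mx0.
by rewrite !big_cons IH tri_entryD.
Qed.

Let triX l (a w c : 'M_l) k :
  tri a w c ^+ k = tri (a ^+ k) (path_sum a w c k) (c ^+ k).
Proof.
elim: k => [|k IH]; last by rewrite !exprS IH triM path_sumS.
apply/matrixP => i j; rewrite /path_sum big_ord0 !mxE /tri_entry.
by case: (i == j); rewrite ?mulr1n ?mulr0n ?raddf0 ?block_mx0 -?scalar_mx_block.
Qed.

Let triP l (a w c : 'M_l) : tri a w c = 0 -> w = 0.
Proof.
move=> /matrixP E; apply/matrixP => i j; have := E i j; rewrite !mxE.
move/(congr1 (@ursubmx _ 1 1 1 1)); rewrite block_mxKur -[0 in RHS]block_mx0 block_mxKur.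
by move/matrixP/(_ ord0 ord0); rewrite !mxE mulr1n.
Qed.

(* The polarisation of a ^+ (2 * l) = 0 in the direction w: the 2 x 2 matrices
   [[a i j, w i j], [0, (-1) ^+ s * a i j]] anticommute. *)
Lemma path_sum_odd l (a w : 'M[L]_l) (s : bool) :
    anticommuting (entry a) -> sgn_comm (entry a) (~~ s) w ->
  path_sum a w ((-1) ^+ s * a) (2 * l) = 0.
Proof.
move=> [aC aK] aw.
have cE i j : ((-1) ^+ s * a) i j = (-1) ^+ s * a i j.
  by rewrite !mulr_sign; case: (s); rewrite ?mxE.
move: (_ * a) cE => c cE.
apply: (triP (a := a ^+ (2 * l)) (c := c ^+ (2 * l))); rewrite -triX.
have E i j i' j' : a i j * w i' j' + w i j * c i' j' + (a i' j' * w i j + w i' j' * c i j) = 0.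
  rewrite !cE !aw; try by [exists i, j|exists i', j'].
  case: (s); rewrite !(mul1r, mulN1r, mulrN).
    by rewrite addrA subrK subrr.
  by rewrite addrA addrK addNr.
apply: amitsur_levitzki; split=> [_ _ [i [j ->]] [i' [j' ->]]|_ [i [j ->]]];
  rewrite !mxE !tri_entryM.
  apply/eqP; rewrite -subr_eq0 opprK tri_entryD E.
  have aa : a i j * a i' j' = - (a i' j' * a i j) by apply: aC; [exists i, j|exists i', j'].
  rewrite aa addNr !cE !mulr_sign; case: (s); rewrite ?mulrNN aa addNr;
  by rewrite /tri_entry !raddf0 block_mx0.
have aa : a i j * a i j = 0 by apply: aK; exists i, j.
have aw0 : a i j * w i j + w i j * c i j = 0.
  rewrite aw ?cE; last by exists i, j.
  by case: (s); rewrite !(mul1r, mulN1r, mulrN) ?subrr ?addNr.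
rewrite aw0 aa !cE mulr_sign; case: (s); rewrite ?mulrNN aa;
by rewrite /tri_entry !raddf0 block_mx0.
Qed.

Section TwoTerms.
Variables (l : nat) (a : 'M[L]_l.+1).
Hypothesis a_anti : anticommuting (entry a).

Let aX : a ^+ (2 * l).+2 = 0.
Proof. by have := amitsur_levitzki a_anti; rewrite mulnS. Qed.

(** Multiplying the polarised identity on the left by [a ^+ (2 * l).+1] kills every term except the
    one that begins with [w]. *)
Lemma linked_even w : sgn_comm (entry a) false w ->
  a ^+ (2 * l).+1 *m w *m a ^+ (2 * l).+1 = 0.
Proof.
move=> aw; have := path_sum_odd (s := true) a_anti aw.
rewrite mulnS add2n path_sumS => /(congr1 (mulmx (a ^+ (2 * l).+1))).
rewrite mulmx0 mulmxDr mulmxA mulmxE -exprSr aX mul0r add0r.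
have sg : (-1) ^+ (2 * l).+1 = -1 :> 'M[L]_l.+1 by rewrite -signr_odd /= mul2n odd_double.
rewrite mulr_sign exprNn sg mulN1r.
by rewrite !mulrN mulrA => /eqP; rewrite oppr_eq0 => /eqP.
Qed.

(** Multiplying by one power of [a] less than in [linked_even] leaves two terms. *)
Lemma linked_odd w : sgn_comm (entry a) true w ->
  a ^+ (2 * l).+1 *m w *m a ^+ (2 * l) + a ^+ (2 * l) *m w *m a ^+ (2 * l).+1 = 0.
Proof.
move=> aw; have := path_sum_odd (s := false) a_anti aw.
rewrite mul1r mulnS add2n path_sumS path_sumS => /(congr1 (mulmx (a ^+ (2 * l)))).
rewrite mulmx0 !mulmxDr !mulmxA !mulmxE -!exprSr aX mul0r add0r => <-.
by rewrite -!mulmxE.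
Qed.

End TwoTerms.

(** Only the corner joining the first block to the last needs care. Its terms have the form
    [a ^ i z a ^ j] or [a ^ i x b ^ j y a ^ k]; nilpotency of [a] and [b] leaves few of them, and
    these cancel because both end blocks equal [a]. *)
Lemma linked_exp l m (a : 'M[L]_l.+1) (x : 'M[L]_(l.+1, m)) z (b : 'M_m) y :
    let alpha : 'M_(l.+1 + (m + l.+1)) :=
      block_mx a (row_mx x z) 0 (block_mx b y 0 a) in
    anticommuting (entry alpha) ->
  alpha ^+ (2 * (l.+1 + (m + l.+1)) - 2) = 0.
Proof.
move=> alpha al_anti; set beta := block_mx b y 0 a in alpha al_anti *.
have sub_anti m1 n1 (M : 'M[L]_(m1, n1)) :
    (forall i j, entry alpha (M i j)) -> anticommuting (entry M).
  case: al_anti => [C K] aM.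
  by split=> [_ _ [i [j ->]] [i' [j' ->]]|_ [i [j ->]]]; [apply: C|apply: K].
have xE i j : entry alpha (x i j).
  by exists (lshift _ i), (rshift _ (lshift _ j)); rewrite block_mxEur row_mxEl.
have zE i j : entry alpha (z i j).
  by exists (lshift _ i), (rshift _ (rshift _ j)); rewrite block_mxEur row_mxEr.
have betaE i j : entry alpha (beta i j).
  by exists (rshift _ i), (rshift _ j); rewrite block_mxEdr.
have bE i j : entry alpha (b i j).
  by have := betaE (lshift _ i) (lshift _ j); rewrite block_mxEul.
have yE i j : entry alpha (y i j).
  by have := betaE (lshift _ i) (rshift _ j); rewrite block_mxEur.
have aE i j : entry alpha (a i j).
  by exists (lshift _ i), (lshift _ j); rewrite block_mxEul.
have comm_sub s m1 n1 (M : 'M[L]_(m1, n1)) :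
    sgn_comm (entry alpha) s M -> sgn_comm (entry a) s M.
  by move=> cM t i j [i' [j' ->]]; apply: cM.
have a_anti := sub_anti _ _ _ aE.
have aX : a ^+ (2 * l).+2 = 0 by have := amitsur_levitzki a_anti; rewrite mulnS.
have xc := sgn_comm_odd al_anti xE; have yc := sgn_comm_odd al_anti yE.
have zc := sgn_comm_odd al_anti zE; have bc := sgn_comm_odd al_anti bE.
have bX : b ^+ (2 * m) = 0 by apply/amitsur_levitzki/sub_anti.
have betaX : beta ^+ (2 * m + 2 * l).+2 = 0.
  have := amitsur_levitzki (sub_anti _ _ _ betaE); congr (_ ^+ _ = _); lia.
have -> : (2 * (l.+1 + (m + l.+1)) - 2 = (2 * l + (2 * m + 2 * l)).+2)%N by lia.
rewrite block_upper_exp path_sum_two // -addnS -addSn.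
have -> : beta ^+ (2 * l + (2 * m + 2 * l).+1).+1 = 0.
  have -> : ((2 * l + (2 * m + 2 * l).+1).+1 = (2 * m + 2 * l).+2 + 2 * l)%N by lia.
  by rewrite exprD betaX mul0r.
have -> : a ^+ (2 * l + (2 * m + 2 * l).+1).+1 = 0.
  have -> : ((2 * l + (2 * m + 2 * l).+1).+1 = (2 * l).+2 + (2 * m + 2 * l))%N by lia.
  by rewrite exprD aX mul0r.
rewrite !block_upper_exp -!mulmxA !mul_row_block !mulmx0 !addr0 !mul_mx_row add_row_mx.
apply: etrans (block_mx0 _ _ _ _ _); rewrite -row_mx0; congr (block_mx _ (row_mx _ _) _ _).
  rewrite [in X in X + _]exprD [in X in _ + X]exprS [in X in _ + X]exprD bX.
  by rewrite mul0r mulr0 !mulmx0 addr0.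
rewrite !mulmxDr addrACA.
(* The direct paths through [z] form the pair of [linked_odd], times [a ^+ (2 * m)]. *)
have z0 : a ^+ (2 * l).+1 *m (z *m a ^+ (2 * m + 2 * l)) +
    a ^+ (2 * l) *m (z *m a ^+ (2 * m + 2 * l).+1) = 0.
  have -> : a ^+ (2 * m + 2 * l) = a ^+ (2 * l) *m a ^+ (2 * m) by rewrite mulmxE -exprD addnC.
  have -> : a ^+ (2 * m + 2 * l).+1 = a ^+ (2 * l).+1 *m a ^+ (2 * m).
    by rewrite mulmxE -exprD addSn addnC.
  by rewrite !mulmxA -mulmxDl linked_odd ?mul0mx //; apply: comm_sub.
rewrite z0 addr0 => {z0}.
have [m0|m_gt0] := posnP m.
  have x0 p (Y : 'M_(m, p)) : x *m Y = 0.
    apply/matrixP => i j; rewrite !mxE big1 // => k _.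
    by have := ltn_ord k; rewrite [X in (_ < X)%N]m0.
  by rewrite !x0 !mulmx0 addr0.
have [k mk] : exists k, (2 * m = k.+2)%N by exists (2 * m - 2)%N; lia.
have bX1 : b ^+ k.+2 = 0 by rewrite -mk.
rewrite mk !addSn path_sum_two //; have -> : ((k + 2 * l).+3 = (k.+1 + (2 * l).+1).+1)%N by lia.
rewrite path_sum_one // !mulmxDr addrAC addrC !mulmxA.
have k_odd : odd k = false by have : odd k.+2 = false; [rewrite -mk; lia|rewrite /= negbK].
have xby p : sgn_comm (entry alpha) (odd p) (x *m b ^+ p *m y).
  have := sgn_comm_mul (sgn_comm_mul xc (sgn_comm_exp p bc)) yc.
  by rewrite addbC addbA addbb.
have assoc p q r : a ^+ p *m x *m b ^+ q *m y *m a ^+ r =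
    a ^+ p *m (x *m b ^+ q *m y) *m a ^+ r.
  by rewrite !mulmxA.
(* Of the three surviving terms, one has the middle factor [x b ^ k y] of even degree; the other two
   share [x b ^ (k + 1) y], of odd degree. *)
rewrite !assoc linked_even ?add0r ?linked_odd //; apply: comm_sub.
  by have := xby k.+1; rewrite /= k_odd.
by have := xby k; rewrite k_odd.
Qed.
End LinkedBlocks.

(** * Irreducible algebras *)

Lemma ex_maxr T (P : T -> Prop) (f : T -> nat) b :
    (exists x, P x) -> (forall x, P x -> f x <= b)%N ->
  exists x, P x /\ forall y, P y -> (f y <= f x)%N.
Proof.
move=> [x0 Px0] fb; apply: contrapT => no_max.
have step k : exists x, P x /\ (k <= f x)%N.
  elim: k => [|k [x [Px kx]]]; first by exists x0.
  apply: contrapT => no; apply: no_max; exists x; split=> // y Py.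
  rewrite leqNgt; apply/negP => xy; apply: no; exists y; split=> //.
  exact: leq_ltn_trans kx xy.
by have [x [Px]] := step b.+1; rewrite ltnNge fb.
Qed.

Lemma ex_minr T (P : T -> Prop) (f : T -> nat) :
    (exists x, P x) -> exists x, P x /\ forall y, P y -> (f x <= f y)%N.
Proof.
move=> [x0 Px0].
have [|y|x [[Px xx0] x_max]] := ex_maxr (P := fun x => P x /\ (f x <= f x0)%N)
    (f := fun x => (f x0 - f x)%N) (b := f x0).
- by exists x0.
- by rewrite leq_subr.
exists x; split=> // y Py; have [yx0|/ltnW] := leqP (f y) (f x0); last exact: leq_trans.
by have := x_max y (conj Py yx0); lia.
Qed.

Section Algebras.
Variable F : fieldType.

Definition subalg n (A : 'M[F]_n -> Prop) : Prop :=
  [/\ A 1%:M, forall c x y, A x -> A y -> A (c *: x + y)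
    & forall x y, A x -> A y -> A (x *m y)].

Definition linear_set (V : lmodType F) (S : V -> Prop) : Prop :=
  S 0 /\ forall c x y, S x -> S y -> S (c *: x + y).

Section LinearSet.
Variables (V : lmodType F) (S : V -> Prop).
Hypothesis S_lin : linear_set S.

Lemma linear_setD x y : S x -> S y -> S (x + y).
Proof. by move=> Sx Sy; rewrite -[x]scale1r; apply: S_lin.2. Qed.

Lemma linear_setZ c x : S x -> S (c *: x).
Proof. by move=> Sx; rewrite -[_ *: _]addr0; apply: S_lin.2; last exact: S_lin.1. Qed.

Lemma linear_setB x y : S x -> S y -> S (x - y).
Proof. by move=> Sx Sy; rewrite addrC -scaleN1r; apply: S_lin.2. Qed.

Lemma linear_set_sum (I : Type) (s : seq I) (P : pred I) (f : I -> V) :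
  (forall i, P i -> S (f i)) -> S (\sum_(i <- s | P i) f i).
Proof. by move=> Sf; apply: big_ind => //; [exact: S_lin.1|exact: linear_setD]. Qed.

End LinearSet.

Lemma subalg_linear n (A : 'M[F]_n -> Prop) : subalg A -> linear_set A.
Proof.
case=> A1 AL _; split=> //.
have -> : 0 = (-1) *: 1%:M + 1%:M :> 'M[F]_n by rewrite scaleN1r addNr.
exact: AL.
Qed.

(** Take a matrix of maximal rank with row space inside [S]: adjoining a vector of [S] cannot raise
    the rank. *)
Lemma linear_set_mx n (S : 'rV[F]_n -> Prop) :
  linear_set S -> exists M : 'M[F]_n, forall v, (v <= M)%MS <-> S v.
Proof.
move=> S_lin.
have [||M [MS M_max]] := ex_maxr (P := fun M : 'M[F]_n => forall v, (v <= M)%MS -> S v)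
    (f := fun M : 'M[F]_n => \rank M) (b := n).
- by exists 0 => v; rewrite submx0 => /eqP ->; apply: S_lin.1.
- by move=> M _; apply: rank_leq_row.
exists M => v; split; first exact: MS.
move=> Sv; have MvS w : (w <= M + v)%MS -> S w.
  move=> /sub_addsmxP[[u1 u2] /= ->]; apply: linear_setD => //.
    by apply: MS; apply: submxMl.
  by rewrite (mx11_scalar u2) mul_scalar_mx; apply: linear_setZ.
have := M_max _ MvS; rewrite (geq_leqif (mxrank_leqif_sup (addsmxSl M v))).
by apply: submx_trans; apply: addsmxSr.
Qed.

Lemma mulmx_deltaE m n p q (x : 'M[F]_(m, n)) (y : 'M_(p, q)) j i k l :
  (x *m delta_mx j i *m y) k l = x k j * y i l.
Proof.
rewrite mxE (bigD1 i) //= big1 => [|h /negbTE hi].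
  rewrite addr0 mxE (bigD1 j) //= big1 => [|h /negbTE hj]; last by rewrite !mxE hj mulr0.
  by rewrite !mxE !eqxx mulr1 addr0.
by rewrite mxE big1 ?mul0r // => h' _; rewrite !mxE hi andbF mulr0.
Qed.

Lemma matrix_ideal l (I : 'M[F]_l -> Prop) a :
    linear_set I -> (forall x y, I x -> I (y *m x)) -> (forall x y, I x -> I (x *m y)) ->
    I a -> a != 0 -> forall c, I c.
Proof.
move=> I_lin Il Ir Ia /eqP a0 c.
have [i [j aij]] : exists i j, a i j != 0.
  apply: contrapT => no; apply: a0; apply/matrixP => i j; rewrite mxE.
  by apply/eqP/negPn/negP => aij; apply: no; exists i, j.
rewrite [c]matrix_sum_delta; apply: linear_set_sum => // p _.
apply: linear_set_sum => // q _.
have -> : c p q *: delta_mx p q = (c p q / a i j) *: (delta_mx p i *m a *m delta_mx j q).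
  have -> : delta_mx p i *m a *m delta_mx j q = a i j *: delta_mx p q.
    apply/matrixP => r s; rewrite !mxE (bigD1 j) //= big1 => [|k /negbTE kj]; last first.
      by rewrite !mxE kj mulr0.
    rewrite !mxE eqxx addr0 (bigD1 i) //= big1 => [|k /negbTE ki]; last first.
      by rewrite !mxE ki andbF mul0r.
    by rewrite !mxE eqxx andbT addr0; case: eqP; case: eqP; rewrite ?(mulr1, mul1r, mulr0, mul0r).
  by rewrite scalerA divfK.
by apply: linear_setZ => //; apply/Ir/Il.
Qed.

(** Simplicity of the module of row vectors: every nonzero vector is cyclic. *)
Definition irred l (A : 'M[F]_l -> Prop) : Prop :=
  forall v u : 'rV_l, v != 0 -> exists2 r, A r & v *m r = u.

Section Irreducible.
Variables (l : nat) (A : 'M[F]_l -> Prop).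
Hypotheses (A_alg : subalg A) (A_irr : irred A).

Let A_lin : linear_set A := subalg_linear A_alg.

Let A1 : A 1%:M. Proof. by case: A_alg. Qed.

Let AM x y : A x -> A y -> A (x *m y). Proof. by case: A_alg => _ _; apply. Qed.

(** Jacobson density for a scalar commutant. The inductive step needs an [r] that kills the rows of
    [X'] but not the new row [v]. *)
Lemma density :
    (forall d, (forall r, A r -> r *m d = d *m r) -> exists c, d = c%:M) ->
  forall k (X : 'M_(k, l)), row_free X -> forall Y, exists2 r, A r & X *m r = Y.
Proof.
move=> comm_scalar; elim=> [X _ Y|k IH].
  by exists 1%:M => //; rewrite [RHS]flatmx0 [LHS]flatmx0.
rewrite -[k.+1]/(1 + k)%N => X Xfree Y.
pose v := usubmx X; pose X' := dsubmx X.
have XE : X = col_mx v X' by rewrite vsubmxK.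
have [B XB] := row_freeP Xfree.
have X'free : row_free X'.
  apply/row_freeP; exists (B *m col_mx 0 1%:M); rewrite mulmxA.
  have : X' *m B = row_mx 0 1%:M.
    have /(congr1 dsubmx) := XB.
    by rewrite XE mul_col_mx col_mxKd => ->; rewrite scalar_mx_block /block_mx col_mxKd.
  by move=> ->; rewrite mul_row_col mul0mx add0r mul1mx.
have v_notin : ~ exists D, v = D *m X'.
  move=> [D vE]; have /(congr1 (mulmx (row_mx 1%:M (- D)))) := XB.
  rewrite mulmxA XE mul_row_col mul1mx mulNmx -vE subrr mul0mx mulmx1.
  move/(congr1 lsubmx); rewrite row_mxKl => /matrixP/(_ 0 0).
  by rewrite !mxE => /esym/eqP; rewrite oner_eq0.
have [r [Ar X'r vr]] : exists r, [/\ A r, X' *m r = 0 & v *m r != 0].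
  apply: contrapT => no; apply: v_notin.
  have kill r : A r -> X' *m r = 0 -> v *m r = 0.
    by move=> Ar X'r; apply/eqP/negPn/negP => vr; apply: no; exists r.
  have D (ij : 'I_k * 'I_l) : exists r, A r /\ X' *m r = delta_mx ij.1 ij.2.
    by have [r] := IH X' X'free (delta_mx ij.1 ij.2); exists r.
  have [e eP] := choice D.
  (* Without such an [r], [v *m r] depends only on [X' *m r], through the matrices [d i]. These
     commute with [A], hence are scalar, and [r = 1] makes [v] a combination of the rows of [X']. *)
  pose d i : 'M_l := \matrix_j (v *m e (i, j)).
  have vE r : A r -> v *m r = \sum_i row i (X' *m r) *m d i.
    move=> Ar; pose r' := \sum_i \sum_j (X' *m r) i j *: e (i, j).
    have Ar' : A r'.
      apply: linear_set_sum => // i _; apply: linear_set_sum => // j _.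
      by apply: linear_setZ => //; case: (eP (i, j)).
    have X'r' : X' *m r' = X' *m r.
      rewrite [RHS]matrix_sum_delta mulmx_sumr; apply: eq_bigr => i _.
      rewrite mulmx_sumr; apply: eq_bigr => j _.
      by rewrite -scalemxAr; case: (eP (i, j)) => _ ->.
    have -> : v *m r = v *m r'.
      apply/eqP; rewrite -subr_eq0 -mulmxBr kill ?mulmxBr ?X'r' ?subrr //.
      exact: linear_setB.
    rewrite mulmx_sumr; apply: eq_bigr => i _.
    rewrite mulmx_sumr mulmx_sum_row; apply: eq_bigr => j _.
    by rewrite -scalemxAr rowK !mxE.
  have d_scalar i : exists c, d i = c%:M.
    apply: comm_scalar => s As; apply/row_matrixP => j; rewrite !row_mul rowK.
    have [Ae X'e] := eP (i, j); rewrite -mulmxA vE; last exact: AM.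
    rewrite mulmxA X'e /= (bigD1 i) //= big1 => [|i' /negbTE i'i].
      by rewrite addr0 row_mul rowE mul_delta_mx -rowE.
    rewrite row_mul (_ : row i' _ = 0) ?mul0mx //.
    by apply/rowP => a; rewrite !mxE i'i.
  have [c cE] := choice d_scalar.
  exists (\row_i c i); have := vE _ A1; rewrite !mulmx1 => ->.
  rewrite mulmx_sum_row; apply: eq_bigr => i _.
  by rewrite cE mul_mx_scalar mxE.
have [r1 Ar1 X'r1] := IH X' X'free (dsubmx Y).
have [s As vrs] := A_irr (usubmx Y - v *m r1) vr.
exists (r1 + r *m s); first by apply: linear_setD => //; apply: AM.
rewrite XE mul_col_mx !mulmxDr !mulmxA X'r X'r1 vrs mul0mx addr0 addrC subrK.
by rewrite vsubmxK.
Qed.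

End Irreducible.

(** The kernel of [q(d)] is a submodule. If [q(d)] is nonzero this kernel is 0, so the cofactor of
    [q] already annihilates [d], which forces [q] to be constant. *)
Lemma minpoly_irreducible l (A : 'M[F]_l.+1 -> Prop) (d : 'M_l.+1) :
    irred A -> (forall r, A r -> r *m d = d *m r) ->
  irreducible_poly (mxminpoly d).
Proof.
move=> A_irr dC; set p := mxminpoly d.
have p_monic : p \is monic by apply: mxminpoly_monic.
have p0 : p != 0 by apply: monic_neq0.
split; first by rewrite size_mxminpoly ltnS mxminpoly_nonconstant.
move=> q q1 /dvdpP[g pE].
have qC r : A r -> r *m horner_mx d q = horner_mx d q *m r.
  move=> Ar; exact: (comm_mx_horner q (dC r Ar)).
have [q_d|/eqP q_d] := eqVneq (horner_mx d q) 0.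
  by rewrite /eqp mxminpoly_min // andbT pE dvdp_mull.
have ker0 (v : 'rV_l.+1) : v *m horner_mx d q = 0 -> v = 0.
  move=> vq; apply/eqP/negPn/negP => v0; apply: q_d; apply/row_matrixP => i.
  have [r Ar vr] := A_irr v (delta_mx 0 i) v0.
  by rewrite rowE -vr -mulmxA qC // mulmxA vq mul0mx row0.
have g_d : horner_mx d g = 0.
  apply/row_matrixP => i; rewrite row0; apply: ker0.
  have := mx_root_minpoly d; rewrite -/p pE rmorphM /= => E.
  by rewrite -row_mul mulmxE E row0.
have g0 : g != 0 by apply: contraNneq p0 => g0; rewrite pE g0 mul0r.
have q0 : q != 0 by apply: contraNneq p0 => q0; rewrite pE q0 mulr0.
have := dvdp_leq g0 (mxminpoly_min g_d); rewrite -/p pE size_mul //.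
move: q1; rewrite -size_poly_gt0 in q0; rewrite -size_poly_gt0 in g0.
by move: (size q) (size g) q0 g0 => [|[|a]] [|b] //=; lia.
Qed.

(* A non-scalar [d] commuting with [A] has an eigenvalue [z] in an extension
   [L] of [F]; [A] acts faithfully on the proper quotient of [L ^ l] by the
   image of [d - z]. *)
Lemma irred_sat l (A : 'M[F]_l -> Prop) (d : 'M_l) :
    irred A -> (forall r, A r -> r *m d = d *m r) -> (forall c, d <> c%:M) ->
  sat A (2 * l - 2).
Proof.
case: l A d => [|l] A d A_irr dC d_nscal.
  by case: (d_nscal 0); rewrite [LHS]flatmx0 [RHS]flatmx0.
have [L _ [z pz _]] := irredp_FAdjoin (minpoly_irreducible A_irr dC).
pose toL m n := map_mx (m := m) (n := n) (in_alg L).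
have z_eig : eigenvalue (toL _ _ d) z.
  by rewrite eigenvalue_root_min mxminpoly_map.
pose e := toL _ _ d - z%:M.
have e0 : e != 0.
  apply/eqP => /matrixP E; apply: (d_nscal (d 0 0)); apply/matrixP => i j.
  have dE i' j' : in_alg L (d i' j') = z *+ (i' == j').
    by have /eqP := E i' j'; rewrite !mxE subr_eq0 => /eqP.
  apply: (fmorph_inj (in_alg L)); rewrite mxE rmorphMn.
  by apply: etrans (dE i j) _; congr (_ *+ _); apply/esym/(etrans (dE 0 0)); rewrite eqxx.
(* Transposing gives the right kernel of [e]: multiplication by [K] below is the projection of row
   vectors onto the quotient by the row space of [e]. *)
pose H := kermx e^T.
have H_lt : (\rank H < l.+1)%N.
  have : (0 < \rank e)%N by rewrite lt0n mxrank_eq0.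
  by rewrite mxrank_ker mxrank_tr; lia.
have H0 : H != 0.
  rewrite -mxrank_eq0 mxrank_ker mxrank_tr -lt0n subn_gt0 ltn_neqAle rank_leq_row andbT.
  apply/negP => e_free; case/eigenvalueP: z_eig => v vd /negP[]; apply/eqP.
  have : v *m e = 0 by rewrite mulmxBr vd mul_mx_scalar subrr.
  by move/eqP; rewrite mulmx_free_eq0 // => /eqP.
move=> r Ar; pose K := (row_base H)^T.
have rK s : A s -> exists b, K *m b = toL _ _ s *m K.
  move=> As.
  have : (row_base H *m (toL _ _ s)^T <= row_base H)%MS.
    rewrite (eqmxMr _ (eq_row_base H)) eq_row_base; apply/sub_kermxP.
    rewrite -mulmxA -trmx_mul mulmxBl -map_mxM -dC // map_mxM -scalar_mxC -mulmxBr.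
    by rewrite trmx_mul mulmxA mulmx_ker mul0mx.
  case/submxP => b bE; exists b^T.
  by rewrite /K -[LHS]trmx_mul -bE [LHS]trmx_mul trmxK.
have [b bE] := choice (fun i => rK _ (Ar i)).
have := standard_intertwine bE.
rewrite (sat_matrix (A := fun => True)) ?mulmx0 //; last by lia.
rewrite -(standard_poly_rmorph (toL l.+1 l.+1)) => sK.
(* Faithfulness: a nonzero vector over [F] killed by [K] generates all unit vectors under [A], which
   would give [K = 0]. *)
have KF (v : 'rV[F]_l.+1) : toL _ _ v *m K = 0 -> v = 0.
  move=> vK; apply/eqP/negPn/negP => v0; case/negP: H0.
  have K0 : K = 0.
    apply/row_matrixP => i; rewrite row0 rowE.
    have [s As vs] := A_irr v (delta_mx 0 i) v0; have [c cE] := rK s As.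
    by rewrite -(map_delta_mx (in_alg L)) -vs map_mxM -mulmxA -cE mulmxA vK mul0mx.
  by rewrite -mxrank_eq0 -(eq_row_base H) -mxrank_tr -/K K0 mxrank0.
by apply/row_matrixP => i; rewrite row0; apply: KF; rewrite /toL map_row -row_mul -sK row0.
Qed.

Lemma irred_full_or_sat l (A : 'M[F]_l -> Prop) :
  subalg A -> irred A -> (forall c, A c) \/ sat A (2 * l - 2).
Proof.
move=> A_alg A_irr.
have [comm_scalar|] := EM (forall d, (forall r, A r -> r *m d = d *m r) -> exists c, d = c%:M).
  left=> c; have [|r Ar] := density A_alg A_irr comm_scalar (X := 1%:M) _ c.
    by rewrite row_free_unit unitmx1.
  by rewrite mul1mx => <-.
move=> no; right; apply: contrapT => nsat; apply: no => d dC.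
apply: contrapT => d_nscal; apply: nsat; apply: (irred_sat A_irr dC) => c dE.
by apply: d_nscal; exists c.
Qed.

End Algebras.

(** * Block triangular algebras *)

Section BlockTriangular.
Variable F : fieldType.

HB.instance Definition _ m1 m2 n1 n2 := GRing.Linear.copy
  (@ulsubmx F m1 m2 n1 n2) (@lsubmx F m1 n1 n2 \o @usubmx F m1 m2 (n1 + n2)).
HB.instance Definition _ m1 m2 n1 n2 := GRing.Linear.copy
  (@ursubmx F m1 m2 n1 n2) (@rsubmx F m1 n1 n2 \o @usubmx F m1 m2 (n1 + n2)).
HB.instance Definition _ m1 m2 n1 n2 := GRing.Linear.copy
  (@dlsubmx F m1 m2 n1 n2) (@lsubmx F m2 n1 n2 \o @dsubmx F m1 m2 (n1 + n2)).
HB.instance Definition _ m1 m2 n1 n2 := GRing.Linear.copy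
  (@drsubmx F m1 m2 n1 n2) (@rsubmx F m2 n1 n2 \o @dsubmx F m1 m2 (n1 + n2)).

Definition image_set (T U : Type) (f : T -> U) (A : T -> Prop) (b : U) : Prop :=
  exists2 r, A r & f r = b.

Section TwoBlocks.
Variables m1 m2 : nat.
Implicit Types r s : 'M[F]_(m1 + m2).

Lemma ulsubmx_mul r s : dlsubmx s = 0 -> ulsubmx (r *m s) = ulsubmx r *m ulsubmx s.
Proof.
move=> s0; rewrite -{1}[r]submxK -{1}[s]submxK mulmx_block block_mxKul s0.
by rewrite mulmx0 addr0.
Qed.

Lemma ursubmx_mul r s : ursubmx (r *m s) = ulsubmx r *m ursubmx s + ursubmx r *m drsubmx s.
Proof. by rewrite -{1}[r]submxK -{1}[s]submxK mulmx_block block_mxKur. Qed.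

Lemma drsubmx_mul r s : dlsubmx r = 0 -> drsubmx (r *m s) = drsubmx r *m drsubmx s.
Proof.
move=> r0; rewrite -{1}[r]submxK -{1}[s]submxK mulmx_block block_mxKdr r0.
by rewrite mul0mx add0r.
Qed.

Lemma ulsubmx1 : ulsubmx (1%:M : 'M[F]_(m1 + m2)) = 1%:M.
Proof. by rewrite scalar_mx_block block_mxKul. Qed.

Lemma drsubmx1 : drsubmx (1%:M : 'M[F]_(m1 + m2)) = 1%:M.
Proof. by rewrite scalar_mx_block block_mxKdr. Qed.

End TwoBlocks.

Lemma subalg_image n d (A : 'M[F]_n -> Prop) (f : {linear 'M[F]_n -> 'M[F]_d}) :
    subalg A -> f 1%:M = 1%:M ->
    (forall r s, A r -> A s -> f (r *m s) = f r *m f s) ->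
  subalg (image_set f A).
Proof.
case=> A1 AL AM f1 fM; split; first by exists 1%:M.
  by move=> c _ _ [r Ar <-] [s As <-]; exists (c *: r + s); [apply: AL|rewrite linearP].
by move=> _ _ [r Ar <-] [s As <-]; exists (r *m s); [apply: AM|rewrite fM].
Qed.

Lemma sat_block m1 m2 (A : 'M[F]_(m1 + m2) -> Prop) p q :
    (forall r, A r -> dlsubmx r = 0) ->
    sat (image_set ulsubmx A) p -> sat (image_set drsubmx A) q ->
  sat A (p + q).
Proof.
move=> A0; apply: (sat_extension (H := row_mx 0 1%:M) (C := col_mx 1%:M 0)
  (H' := col_mx 0 1%:M) (C' := row_mx 1%:M 0)).
- rewrite !mul_col_row !mulmx0 !mul0mx !mulmx1 add_block_mx.
  by rewrite !addr0 !add0r -scalar_mx_block.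
- move=> r Ar; exists (ulsubmx r); first by exists r.
  rewrite -{1}[r]submxK A0 // mul_block_col mul_col_mx.
  by rewrite !mulmx0 !mulmx1 !mul0mx !mul1mx !addr0.
move=> r Ar; exists (drsubmx r); first by exists r.
by rewrite -{1}[r]submxK A0 // mul_row_block mul_mx_row !mul0mx !mul1mx !add0r mulmx0 mulmx1.
Qed.

Definition conj_set n (D : 'M[F]_n) (A : 'M[F]_n -> Prop) : 'M_n -> Prop :=
  image_set (fun r => D *m r *m invmx D) A.

Lemma sat_conj n (D : 'M[F]_n) (A : 'M[F]_n -> Prop) p :
  D \in unitmx -> sat (conj_set D A) p -> sat A p.
Proof.
move=> Du satD r Ar; have := standard_intertwine (K := D) (r := r)
  (r' := fun i => D *m r i *m invmx D) (fun i => esym (mulmxKV Du _)).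
rewrite (satD (fun i => D *m r i *m invmx D)) => [|i]; last by exists (r i).
by rewrite mul0mx => /(congr1 (mulmx (invmx D))); rewrite mulKmx // mulmx0.
Qed.

Lemma subalg_conj n (D : 'M[F]_n) (A : 'M[F]_n -> Prop) :
  D \in unitmx -> subalg A -> subalg (conj_set D A).
Proof.
move=> Du [A1 AL AM]; split.
- by exists 1%:M => //; rewrite mulmx1 mulmxV.
- move=> c _ _ [x Ax <-] [y Ay <-]; exists (c *: x + y); first exact: AL.
  by rewrite mulmxDr mulmxDl -scalemxAr -scalemxAl.
move=> _ _ [x Ax <-] [y Ay <-]; exists (x *m y); first exact: AM.
by rewrite !mulmxA mulmxKV.
Qed.

Lemma block_diag_unit l m (a : 'M[F]_l) (b : 'M[F]_m) :
    a \in unitmx -> b \in unitmx -> block_mx a 0 0 b \in unitmx /\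
  invmx (block_mx a 0 0 b) = block_mx (invmx a) 0 0 (invmx b).
Proof.
move=> au bu; have E : block_mx a 0 0 b *m block_mx (invmx a) 0 0 (invmx b) = 1%:M.
  by rewrite mulmx_block !(mulmx0, mul0mx, addr0, add0r) !mulmxV // -scalar_mx_block.
have [Du _] := mulmx1_unit E; split=> //.
by rewrite -[RHS](mulKmx Du) E mulmx1.
Qed.

Lemma sat_linked l m (A : 'M[F]_(l + (m + l)) -> Prop) :
    (0 < l)%N -> (forall r, A r -> dlsubmx r = 0) ->
    (forall r, A r -> dlsubmx (drsubmx r) = 0) ->
    (forall r, A r -> drsubmx (drsubmx r) = ulsubmx r) ->
  sat A (2 * (l + (m + l)) - 2).
Proof.
case: l A => // l A _ A0 A00 Alink r Ar; apply: standard_poly_eq0 => k th th_anti.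
set a := grassmann th r.
have entry0 i j : (forall p, r p i j = 0) -> a i j = 0.
  by move=> r0; rewrite mxE big1 // => p _; rewrite r0 scale0r.
have a0 : dlsubmx a = 0.
  apply/matrixP => i j; rewrite [LHS]mxE [LHS]mxE entry0 ?mxE // => p.
  by have /matrixP/(_ i j) := A0 _ (Ar p); rewrite !mxE.
have a00 : dlsubmx (drsubmx a) = 0.
  apply/matrixP => i j; do 4!rewrite [LHS]mxE; rewrite entry0 ?mxE // => p.
  by have /matrixP/(_ i j) := A00 _ (Ar p); rewrite !mxE.
have alink : drsubmx (drsubmx a) = ulsubmx a.
  apply/matrixP => i j; do 4!rewrite [LHS]mxE; do 2!rewrite [RHS]mxE.
  rewrite !mxE; apply: eq_bigr => p _; congr (_ *: _).
  by have /matrixP/(_ i j) := Alink _ (Ar p); rewrite !mxE.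
have aE : a = block_mx (ulsubmx a) (row_mx (lsubmx (ursubmx a)) (rsubmx (ursubmx a))) 0
    (block_mx (ulsubmx (drsubmx a)) (ursubmx (drsubmx a)) 0 (ulsubmx a)).
  by rewrite hsubmxK -{2}alink -a00 submxK -a0 submxK.
have : anticommuting (entry a).
  by apply: (anticomm_entry th_anti) => i j; apply: grassmann_entry.
by rewrite aE; apply: linked_exp.
Qed.

Lemma schur n d e (A : 'M[F]_n -> Prop) (f : 'M_n -> 'M[F]_d)
    (g : 'M_n -> 'M_e) (T : 'M[F]_(d, e)) :
    T != 0 -> (forall r, A r -> T *m g r = f r *m T) ->
    irred (image_set f A) -> irred (image_set g A) ->
  row_free T /\ row_full T.
Proof.
move=> T0 Tfg f_irr g_irr; split.
  apply: inj_row_free => v vT; apply/eqP/negPn/negP => v0; case/eqP: T0.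
  apply/row_matrixP => i; rewrite row0 rowE.
  have [_ [r Ar <-] <-] := f_irr v (delta_mx 0 i) v0.
  by rewrite -mulmxA -Tfg // mulmxA vT mul0mx.
have [i Ti] : exists i, row i T != 0.
  apply: contrapT => no; case/eqP: T0; apply/row_matrixP => i; rewrite row0.
  by apply/eqP/negPn/negP => Ti; apply: no; exists i.
rewrite -sub1mx; apply/row_subP => j; have [_ [r Ar <-] <-] := g_irr _ (row j 1%:M) Ti.
by rewrite -row_mul Tfg // row_mul submxMl.
Qed.

(** Conjugating the first block by the isomorphism [T] makes the end blocks equal, as [sat_linked]
    requires. *)
Lemma sat_isomorphic_ends l m s (A : 'M[F]_(l + (m + s)) -> Prop) (T : 'M[F]_(s, l)) :
    (0 < l)%N -> (forall r, A r -> dlsubmx r = 0) ->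
    (forall r, A r -> dlsubmx (drsubmx r) = 0) -> row_free T -> row_full T ->
    (forall r, A r -> T *m ulsubmx r = drsubmx (drsubmx r) *m T) ->
  sat A (2 * (l + (m + s)) - 2).
Proof.
move=> l_gt0 A0 A00 Tfree Tfull T_morph.
have sl : s = l by rewrite -(eqP Tfree : \rank T = s) (eqP Tfull : \rank T = l).
subst s; rewrite row_free_unit in Tfree.
pose D : 'M[F]_(l + (m + l)) := block_mx T 0 0 1%:M.
have [Du invD] : D \in unitmx /\ invmx D = block_mx (invmx T) 0 0 1%:M.
  by rewrite -[in X in _ = X]invmx1; apply: block_diag_unit; rewrite ?unitmx1.
apply: (sat_conj Du); have DE r : A r -> D *m r *m invmx D =
    block_mx (T *m ulsubmx r *m invmx T) (T *m ursubmx r) 0 (drsubmx r).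
  move=> Ar; rewrite invD -{1}[r]submxK A0 // !mulmx_block.
  by rewrite !(mulmx0, mul0mx, mulmx1, mul1mx, addr0, add0r).
apply: sat_linked => // _ [r Ar <-]; rewrite DE ?block_mxKdl ?block_mxKdr ?block_mxKul //.
  exact: A00.
by rewrite T_morph // mulmxK.
Qed.

(** The equation [e] is there to be substituted, so that invariance of [U] becomes the vanishing of
    a lower left block. *)
Lemma adapted_basis n (U : 'M[F]_n) :
  exists m s (e : n = (m + s)%N) (P : 'M[F]_(m + s, n)),
    [/\ row_free P, (dsubmx P :=: U)%MS & s = \rank U].
Proof.
have nE : n = (\rank (U^C) + \rank U)%N by rewrite mxrank_compl subnK // rank_leq_row.
exists (\rank (U^C)), (\rank U), nE, (col_mx (row_base (U^C)%MS) (row_base U)); split=> //.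
  rewrite /row_free -[X in X == _]addsmxE; apply/eqP.
  rewrite (adds_eqmx (eq_row_base _) (eq_row_base _)) -nE addsmxC.
  by apply/eqP/addsmx_compl_full.
by rewrite col_mxKd; apply: eq_row_base.
Qed.
End BlockTriangular.

(** * Maps vanishing on a maximal submodule *)

Section TopRows.
Variable F : fieldType.

(* [A] preserves the span U of the last m basis vectors, and V / U is simple:
   then [A] satisfies s_(2n-2) or contains all maps vanishing on U. *)
Definition top_rows (l m : nat) : Prop :=
  forall A : 'M[F]_(l + m) -> Prop, (0 < l)%N -> subalg A ->
    (forall r, A r -> dlsubmx r = 0) -> irred (image_set ulsubmx A) ->
  sat A (2 * (l + m) - 2) \/ forall a x, A (block_mx a x 0 0).

Section FullRows.
Variables (l m : nat) (A : 'M[F]_(l + m) -> Prop).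
Hypotheses (l_gt0 : (0 < l)%N) (A_alg : subalg A).
Hypothesis A0 : forall r, A r -> dlsubmx r = 0.
Hypothesis A_full : forall c, exists2 r, A r & ulsubmx r = c.

Lemma full_rows a0 : A a0 -> drsubmx a0 = 0 -> ulsubmx a0 != 0 ->
  sat A (2 * (l + m) - 2) \/ forall a x, A (block_mx a x 0 0).
Proof.
move=> Aa0 a0d a0u; have A_lin := subalg_linear A_alg.
have AM x y : A x -> A y -> A (x *m y) by case: A_alg => _ _; apply.
pose I r := A r /\ drsubmx r = 0.
have I_lin : linear_set I.
  split; first by split; [exact: A_lin.1|rewrite linear0].
  move=> c x y [Ax x0] [Ay y0]; split; first exact: A_lin.2.
  by rewrite linearP /= x0 y0 scaler0 addr0.
have Ir x y : I x -> A y -> I (x *m y).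
  by case=> Ax x0 Ay; split; [exact: AM|rewrite drsubmx_mul ?x0 ?mul0mx ?A0].
have Il x y : I x -> A y -> I (y *m x).
  by case=> Ax x0 Ay; split; [exact: AM|rewrite drsubmx_mul ?x0 ?mulmx0 ?A0].
have I_full : forall c, image_set ulsubmx I c.
  apply: (matrix_ideal (a := ulsubmx a0)) => //; last by exists a0.
  - split; first by exists 0; [exact: I_lin.1|rewrite linear0].
    move=> c _ _ [x Ix <-] [y Iy <-].
    by exists (c *: x + y); [exact: I_lin.2|rewrite linearP /=].
  - move=> _ y [x Ix <-]; have [s As <-] := A_full y.
    by exists (s *m x); [exact: Il|rewrite ulsubmx_mul // A0 //; case: Ix].
  move=> _ y [x Ix <-]; have [s As <-] := A_full y.
  by exists (x *m s); [exact: Ir|rewrite ulsubmx_mul // A0].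
pose i0 := Ordinal l_gt0.
(* The submodule obtained by applying the ideal [I] to one basis vector outside [U]. Either it is
   all of [V], or [T] and [U] are proper submodules whose sum is [V] by [I_full]. *)
pose T := image_set (fun r => row (lshift m i0) r) I.
have T_lin : linear_set T.
  split; first by exists 0; [exact: I_lin.1|rewrite linear0].
  move=> c _ _ [x Ix <-] [y Iy <-].
  by exists (c *: x + y); [exact: I_lin.2|rewrite linearP /=].
have [M MT] := linear_set_mx T_lin.
have [M_full|M_lt] := boolP (row_full M); [right|left].
  have T_all v : T v by apply/MT; apply: submx_full.
  suff col_in z : A (col_mx z 0).
    by move=> a x; rewrite /block_mx row_mx0; apply: col_in.
  have D q : exists k, I k /\ row (lshift m i0) k = row q z.
    by have [k] := T_all (row q z); exists k.
  have [k kP] := choice D.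
  have E q : exists e, I e /\ ulsubmx e = delta_mx q i0.
    by have [e] := I_full (delta_mx q i0); exists e.
  have [e eP] := choice E.
  (* [k q] produces row [q] of [z] in position [i0], and [e q] moves it to position [q]. *)
  have ek q : e q *m k q = col_mx (delta_mx q (0 : 'I_1) *m row q z) 0.
    have [[[Ae e0] eu] [[Ak k0] ku]] := (eP q, kP q).
    rewrite -[e q]submxK -[k q]submxK eu e0 k0 !A0 // mulmx_block !mulmx0 !mul0mx !addr0.
    rewrite -[RHS]vsubmxK /block_mx row_mx0; congr col_mx; last by rewrite col_mxKd.
    rewrite -mul_mx_row hsubmxK col_mxKu -ku -row_usubmx [row i0 _]rowE mulmxA.
    by rewrite mul_delta_mx.
  have -> : col_mx z 0 = \sum_q e q *m k q.
    under eq_bigr do rewrite ek.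
    rewrite -[RHS]vsubmxK !linear_sum /=; congr col_mx.
      under eq_bigr do rewrite col_mxKu.
      apply/matrixP => i j; rewrite summxE (bigD1 i) //= big1 => [|q /negbTE qi].
        by rewrite addr0 !mxE big_ord1 !mxE !eqxx mul1r.
      by rewrite !mxE big_ord1 !mxE [i == q]eq_sym qi mul0r.
    by rewrite big1 // => q _; rewrite col_mxKd.
  apply: linear_set_sum => // q _; apply: AM; first by case: (eP q) => -[].
  by case: (kP q) => -[].
have M_rank : (\rank M < l + m)%N by rewrite ltn_neqAle rank_leq_col andbT.
move=> r Ar; set s := standard_poly r.
have Ms : M *m s = 0.
  apply: standard_invariant => [|i]; first by lia.
  apply/row_subP => j; rewrite row_mul; apply/MT.
  have /MT[k Ik <-] : (row j M <= M)%MS by apply: row_sub.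
  by exists (k *m r i); [exact: Ir|rewrite row_mul].
have s_d : dsubmx s = 0.
  pose H := row_mx 0 1%:M : 'M[F]_(m, l + m).
  have <- : H *m s = dsubmx s.
    by rewrite -{1}[s]vsubmxK mul_row_col mul0mx add0r mul1mx.
  apply: standard_invariant => [|i].
    by have := rank_leq_row H; lia.
  by rewrite -[r i]submxK A0 // mul_row_block !mul0mx !mul1mx !add0r; apply/submxP;
    exists (drsubmx (r i)); rewrite mul_mx_row mulmx0 mulmx1.
rewrite -[s]vsubmxK s_d; have -> : usubmx s = 0; last by rewrite col_mx0.
apply/row_matrixP => i; rewrite row0.
have [k Ik ku] := I_full (delta_mx i0 i).
have : row (lshift m i0) k *m s = 0.
  have /MT/submxP[D ->] : T (row (lshift m i0) k) by exists k.
  by rewrite -mulmxA Ms mulmx0.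
rewrite -row_usubmx -[usubmx k]hsubmxK -/(ulsubmx k) ku -{1}[s]vsubmxK s_d.
rewrite -row_mul mul_row_col mulmx0 addr0 row_mul => <-.
by rewrite [LHS]rowE; congr (_ *m _); apply/rowP => j; rewrite !mxE !eqxx.
Qed.
End FullRows.

Section Socle.
Variables (l m s : nat) (A : 'M[F]_(l + (m + s)) -> Prop).
Hypotheses (l_gt0 : (0 < l)%N) (s_gt0 : (0 < s)%N) (A_alg : subalg A).
Hypothesis A0 : forall r, A r -> dlsubmx r = 0.
Hypothesis A00 : forall r, A r -> dlsubmx (drsubmx r) = 0.
Hypothesis top_irr : irred (image_set ulsubmx A).
Hypothesis top_full : forall c, exists2 r, A r & ulsubmx r = c.
Hypothesis socle_irr : irred (image_set (fun r => drsubmx (drsubmx r)) A).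
Hypothesis top_dep : forall r, A r -> drsubmx r = 0 -> ulsubmx r = 0.
Hypothesis IH : top_rows l m.

Let A_lin : linear_set A := subalg_linear A_alg.

Let AM x y : A x -> A y -> A (x *m y). Proof. by case: A_alg => _ _; apply. Qed.

Let A1 : A 1%:M. Proof. by case: A_alg. Qed.

(** [a], [b], [c] are the actions on [V / U], [U / S] and [S], where [U] and [S] are spanned by the
    last [m + s] and the last [s] basis vectors. *)
Let a (r : 'M[F]_(l + (m + s))) : 'M_l := ulsubmx r.
Let b (r : 'M[F]_(l + (m + s))) : 'M_m := ulsubmx (drsubmx r).
Let c (r : 'M[F]_(l + (m + s))) : 'M_s := drsubmx (drsubmx r).

Let a_lin k x y : a (k *: x + y) = k *: a x + a y. Proof. by rewrite /a linearP. Qed.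
Let b_lin k x y : b (k *: x + y) = k *: b x + b y. Proof. by rewrite /b !linearP. Qed.
Let c_lin k x y : c (k *: x + y) = k *: c x + c y. Proof. by rewrite /c !linearP. Qed.

Let aM x y : A y -> a (x *m y) = a x *m a y.
Proof. by move=> Ay; rewrite /a ulsubmx_mul ?A0. Qed.

Let bM x y : A x -> A y -> b (x *m y) = b x *m b y.
Proof. by move=> Ax Ay; rewrite /b drsubmx_mul ?A0 // ulsubmx_mul ?A00. Qed.

Let cM x y : A x -> c (x *m y) = c x *m c y.
Proof. by move=> Ax; rewrite /c drsubmx_mul ?A0 // drsubmx_mul ?A00. Qed.

(** [IH] is applied to the action [q] on [V / S]. If that action satisfies the identity,
    Amitsur-Levitzki on [S] supplies the missing [2 * s]. *)
Lemma quotient_top : sat A (2 * (l + (m + s)) - 2) \/ exists r, [/\ A r, a r = 1%:M & b r = 0].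
Proof.
pose q (r : 'M[F]_(l + (m + s))) : 'M_(l + m) := block_mx (a r) (lsubmx (ursubmx r)) 0 (b r).
have q_alg : subalg (image_set q A).
  split.
  - exists 1%:M => //; rewrite /q /a /b scalar_mx_block block_mxKul block_mxKdr block_mxKur.
    by rewrite scalar_mx_block block_mxKul linear0 -scalar_mx_block.
  - move=> k _ _ [x Ax <-] [y Ay <-]; exists (k *: x + y); first exact: A_lin.2.
    by rewrite /q a_lin b_lin !linearP scale_block_mx add_block_mx scaler0 addr0.
  move=> _ _ [x Ax <-] [y Ay <-]; exists (x *m y); first exact: AM.
  rewrite /q aM // bM // mulmx_block !mulmx0 !mul0mx !addr0 !add0r.
  congr block_mx; rewrite ursubmx_mul linearD /= -mulmx_lsub; congr (_ + _).
  rewrite -{1}[ursubmx x]hsubmxK -{1}[drsubmx y]submxK A00 // mul_row_block row_mxKl.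
  by rewrite mulmx0 addr0.
have q0 r : image_set q A r -> dlsubmx r = 0.
  by case=> x _ <-; rewrite /q block_mxKdl.
have q_irr : irred (image_set ulsubmx (image_set q A)).
  move=> v u v0; have [_ [r Ar <-] <-] := top_irr u v0; exists (a r) => //.
  by exists (q r); [exists r|rewrite /q block_mxKul].
have [q_sat|q_rows] := IH l_gt0 q_alg q0 q_irr; [left|right]; last first.
  have [r Ar rq] := q_rows 1%:M 0; exists r; split=> //.
    by have /(congr1 ulsubmx) := rq; rewrite !block_mxKul.
  by have /(congr1 drsubmx) := rq; rewrite !block_mxKdr.
have -> : (2 * (l + (m + s)) - 2 = 2 * (l + m) - 2 + 2 * s)%N by lia.
pose H : 'M[F]_(s, l + (m + s)) := row_mx 0 (row_mx 0 1%:M).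
pose C : 'M[F]_(l + (m + s), l + m) := block_mx 1%:M 0 0 (col_mx 1%:M 0).
apply: (sat_extension (As := fun _ => True) (H := H) (C := C) (H' := col_mx 0 (col_mx 0 1%:M))
   (C' := block_mx 1%:M 0 0 (row_mx 1%:M 0)) _ _ _ q_sat); last exact: sat_matrix.
- rewrite mulmx_block /H !mul_col_row !mulmx0 !mul0mx !mulmx1 !add0r !addr0.
  by rewrite add_block_mx !(addr0, add0r) add_block_mx !(addr0, add0r) -!scalar_mx_block.
- move=> r Ar; exists (q r); first by exists r.
  rewrite -{1}[r]submxK A0 // /C /q !mulmx_block !mulmx0 !mul0mx !mulmx1 !mul1mx !addr0 !add0r.
  congr block_mx.
    by rewrite -{1}[ursubmx r]hsubmxK mul_row_col mulmx1 mulmx0 addr0.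
  rewrite -{1}[drsubmx r]submxK A00 // mul_block_col mul_col_mx.
  by rewrite !mulmx0 !mulmx1 mul1mx mul0mx !addr0.
move=> r Ar; exists (c r) => //.
rewrite -{1}[r]submxK A0 // /H mul_row_block !mul0mx mulmx0 !add0r mul_mx_row mulmx0.
congr row_mx; rewrite -{1}[drsubmx r]submxK A00 // mul_row_block mul_mx_row.
by rewrite !mulmx0 !mul0mx mul1mx mulmx1 !add0r.
Qed.

(** Such an [r] maps [U] to [S] and [S] to 0, so [r *m t *m r] vanishes on [U] for all [t] in [A].
    Choosing [t] to be a matrix unit on [V / U] leaves the square of an entry of [a r]. *)
Let socle_kernel r : A r -> b r = 0 -> c r = 0 -> a r = 0.
Proof.
move=> Ar br cr; apply/eqP/negPn/negP => ar.
have [i [j aij]] : exists i j, a r i j != 0.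
  apply: contrapT => no; case/negP: ar; apply/eqP/matrixP => i j; rewrite [RHS]mxE.
  by apply/eqP/negPn/negP => aij; apply: no; exists i, j.
have [t At ta] := top_full (delta_mx j i).
have : a (r *m t *m r) = 0.
  apply: top_dep; first by apply: (AM (AM Ar At)).
  have Art := AM Ar At.
  rewrite !drsubmx_mul ?A0 // -[drsubmx r]submxK -[drsubmx t]submxK.
  rewrite -/(b r) -/(c r) br cr !A00 // !mulmx_block !(mulmx0, mul0mx, addr0, add0r).
  by rewrite block_mx0.
rewrite !aM // [a t]ta => /matrixP/(_ i j)/eqP.
by rewrite mulmx_deltaE [X in _ == X]mxE mulf_eq0 (negbTE aij).
Qed.

(** On the ideal [K] of elements mapping [U] into [S], [socle_kernel] makes [a] a function of [c],
    and this function is nonzero by [quotient_top]. It yields a nonzero morphism from [S] to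
    [V / U], an isomorphism by Schur, and [sat_isomorphic_ends] applies. *)
Lemma sat_socle : sat A (2 * (l + (m + s)) - 2).
Proof.
have c_alg : subalg (image_set c A).
  split; first by exists 1%:M => //; rewrite /c !drsubmx1.
    by move=> k _ _ [x Ax <-] [y Ay <-]; exists (k *: x + y); [exact: A_lin.2|rewrite c_lin].
  by move=> _ _ [x Ax <-] [y Ay <-]; exists (x *m y); [exact: AM|rewrite cM].
have [c_full|c_sat] := irred_full_or_sat c_alg socle_irr; last first.
  have -> : (2 * (l + (m + s)) - 2 = 2 * l + (2 * m + (2 * s - 2)))%N by lia.
  apply: sat_block => //; first exact: sat_matrix.
  apply: sat_block => [_ [r Ar <-]||]; [exact: A00|exact: sat_matrix|].
  by move=> r Ar; apply: c_sat => i; have [_ [t At <-] <-] := Ar i; exists t.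
have [//|[r0 [Ar0 ar0 br0]]] := quotient_top.
pose K r := A r /\ b r = 0.
have K_lin : linear_set K.
  split; first by split; [exact: A_lin.1|rewrite /b !linear0].
  by move=> k x y [Ax x0] [Ay y0]; split; [exact: A_lin.2|rewrite b_lin x0 y0 scaler0 addr0].
have Kr x y : K x -> A y -> K (x *m y).
  by case=> Ax x0 Ay; split; [exact: AM|rewrite bM // x0 mul0mx].
have Kl x y : K x -> A y -> K (y *m x).
  by case=> Ax x0 Ay; split; [exact: AM|rewrite bM // x0 mulmx0].
have a1 : 1%:M != 0 :> 'M[F]_l.
  apply/eqP => /matrixP/(_ (Ordinal l_gt0) (Ordinal l_gt0))/eqP.
  by rewrite !mxE eqxx oner_eq0.
have K_full : forall d, image_set c K d.
  apply: (matrix_ideal (a := c r0)).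
  - split; first by exists 0; [exact: K_lin.1|rewrite /c !linear0].
    move=> k _ _ [x Kx <-] [y Ky <-].
    by exists (k *: x + y); [exact: K_lin.2|rewrite c_lin].
  - move=> _ y [x Kx <-]; have [t At <-] := c_full y.
    by exists (t *m x); [exact: Kl|rewrite cM].
  - move=> _ y [x Kx <-]; have [t At <-] := c_full y.
    by exists (x *m t); [exact: Kr|rewrite cM //; case: Kx].
  - by exists r0.
  by apply/eqP => cr0; case/eqP: a1; rewrite -ar0; apply: socle_kernel.
have D (iq : 'I_s * 'I_s) : exists e, K e /\ c e = delta_mx iq.1 iq.2.
  by have [e] := K_full (delta_mx iq.1 iq.2); exists e.
have [e eP] := choice D.
(* [a] restricted to K is a linear function of [c]. *)
have a_c k : K k -> a k = \sum_i \sum_q c k i q *: a (e (i, q)).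
  move=> Kk; pose k' := \sum_i \sum_q c k i q *: e (i, q).
  have Kk' : K k'.
    apply: linear_set_sum => // i _; apply: linear_set_sum => // q _.
    by apply: linear_setZ => //; case: (eP (i, q)).
  have ck' : c k' = c k.
    rewrite /c /k' !linear_sum [RHS]matrix_sum_delta; apply: eq_bigr => i _.
    rewrite !linear_sum; apply: eq_bigr => q _; rewrite !linearZ /=; congr (_ *: _).
    by case: (eP (i, q)).
  have [Akk' bkk'] := linear_setB K_lin Kk Kk'.
  have : a (k - k') = 0.
    by apply: socle_kernel => //; rewrite addrC -scaleN1r c_lin ck' scaleN1r addNr.
  rewrite addrC -scaleN1r a_lin scaleN1r => /(canRL (addKr _)); rewrite addr0 opprK => ->.
  rewrite /a /k' !linear_sum; apply: eq_bigr => i _.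
  by rewrite !linear_sum; apply: eq_bigr => q _; rewrite !linearZ.
have [i [q0 aiq]] : exists i q, a (e (i, q)) != 0.
  apply: contrapT => no; case/eqP: a1; rewrite -ar0 a_c //.
  apply: big1 => i _; apply: big1 => q _.
  have [->|nz] := eqVneq (a (e (i, q))) 0; first by rewrite scaler0.
  by case: no; exists i, q.
have [p ap] : exists p, row p (a (e (i, q0))) != 0.
  apply: contrapT => no; case/eqP: aiq; apply/row_matrixP => p; rewrite row0.
  by apply/eqP/negPn/negP => ap; apply: no; exists p.
(* With [i] fixed, row [i] of [c] runs over a copy of [S]; row [p] of [a] is the corresponding
   vector of [V / U]. *)
pose T : 'M_(s, l) := \matrix_q row p (a (e (i, q))).
have T0 : T != 0.
  by apply: contraNneq ap => T0; rewrite -(rowK (fun q => row p (a (e (i, q)))) q0) -/T T0 row0.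
have T_morph r : A r -> T *m a r = c r *m T.
  move=> Ar; apply/row_matrixP => q; rewrite !row_mul rowK.
  have [Ke ce] := eP (i, q); rewrite -[LHS]row_mul -aM // a_c; last exact: Kr.
  rewrite cM ?ce; last by case: Ke.
  rewrite linear_sum (bigD1 i) //= [X in _ + X]big1 => [|j /negbTE ji]; last first.
    rewrite linear_sum big1 // => q' _; rewrite linearZ /= mxE big1 ?scale0r // => q'' _.
    by rewrite mxE ji mul0r.
  rewrite addr0 linear_sum mulmx_sum_row; apply: eq_bigr => q' _.
  rewrite linearZ /= rowK; congr (_ *: _).
  rewrite -[RHS]mul1r -(mul_delta_mx (0 : 'I_1)) -mulmxA -rowE mxE big_ord1.
  by rewrite [delta_mx _ _ _ _]mxE !eqxx.
have [Tfree Tfull] := schur T0 T_morph socle_irr top_irr.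
exact: (sat_isomorphic_ends l_gt0 A0 A00 Tfree Tfull T_morph).
Qed.

End Socle.
End TopRows.

(** * Induction on submodules and the block triangular form *)

Section Main.
Variable F : fieldType.

Lemma dsubmx_conj l m (P : 'M[F]_(l + m)) r : P \in unitmx ->
    (dsubmx P *m r <= dsubmx P)%MS ->
  dlsubmx (P *m r *m invmx P) = 0 /\
  dsubmx P *m r = drsubmx (P *m r *m invmx P) *m dsubmx P.
Proof.
move=> Pu /submxP[X XE].
have E : dsubmx (P *m r *m invmx P) = row_mx 0 X.
  rewrite -!mul_dsub_mx XE -mulmxA mul_dsub_mx mulmxV // scalar_mx_block.
  by rewrite /block_mx col_mxKd mul_mx_row mulmx0 mulmx1.
by rewrite /dlsubmx /drsubmx E row_mxKl row_mxKr.
Qed.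

Lemma subalg_drsubmx l m (A : 'M[F]_(l + m) -> Prop) : subalg A ->
  (forall r, A r -> dlsubmx r = 0) -> subalg (image_set drsubmx A).
Proof.
move=> A_alg A0; apply: subalg_image => //; first exact: drsubmx1.
by move=> r s Ar As; rewrite /= drsubmx_mul ?A0.
Qed.

(** Induction on [m] supplies the hypothesis of [sat_socle] on [V / S], in which the image of [U] is
    smaller. *)
Lemma top_rowsP l m : top_rows F l m.
Proof.
elim/ltn_ind: m l => m IH l A l_gt0 A_alg A0 top_irr.
have a_alg : subalg (image_set ulsubmx A).
  apply: subalg_image => //; first exact: ulsubmx1.
  by move=> r s Ar As; rewrite /= ulsubmx_mul ?A0.
have [top_full|a_sat] := irred_full_or_sat a_alg top_irr; last first.
  left; have -> : (2 * (l + m) - 2 = 2 * l - 2 + 2 * m)%N by lia.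
  by apply: sat_block => //; apply: sat_matrix.
have [[a0 [Aa0 a0d a0u]]|no_rows] :=
    EM (exists a0, [/\ A a0, drsubmx a0 = 0 & ulsubmx a0 != 0]).
  exact: (full_rows l_gt0 A_alg A0 top_full Aa0).
left; have top_dep r : A r -> drsubmx r = 0 -> ulsubmx r = 0.
  by move=> Ar r0; apply/eqP/negPn/negP => ru; apply: no_rows; exists r.
have A_lin := subalg_linear A_alg.
have AM x y : A x -> A y -> A (x *m y) by case: A_alg => _ _; apply.
have A1 : A 1%:M by case: A_alg.
(* If [U] were 0, the identity would vanish on [U] and contradict [top_dep]. *)
have m_gt0 : (0 < m)%N.
  rewrite lt0n; apply/eqP => m0; have := top_dep _ A1.
  rewrite drsubmx1 ulsubmx1 => E.
  have /matrixP/(_ (Ordinal l_gt0) (Ordinal l_gt0))/eqP : 1%:M = 0 :> 'M[F]_l.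
    by apply: E; apply/matrixP => i; have := ltn_ord i; rewrite [X in (_ < X)%N]m0.
  by rewrite !mxE eqxx oner_eq0.
(* A nonzero submodule of [U] of least dimension is simple. *)
have [|S [[S0 S_inv] S_min]] := ex_minr (fun S : 'M[F]_m => \rank S)
    (P := fun S => S != 0 /\ forall r, A r -> (S *m drsubmx r <= S)%MS).
  exists 1%:M; split; last by move=> r _; rewrite submx1.
  apply/eqP => /matrixP/(_ (Ordinal m_gt0) (Ordinal m_gt0))/eqP.
  by rewrite !mxE eqxx oner_eq0.
have [m1 [s [mE [P [Pfree PS sE]]]]] := adapted_basis S.
subst m; have Pu : P \in unitmx by rewrite -row_free_unit.
have s_gt0 : (0 < s)%N by rewrite sE lt0n mxrank_eq0.
pose D : 'M[F]_(l + (m1 + s)) := block_mx 1%:M 0 0 P.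
have [Du invD] : D \in unitmx /\ invmx D = block_mx 1%:M 0 0 (invmx P).
  by rewrite -[in X in _ = X]invmx1; apply: block_diag_unit; rewrite ?unitmx1.
have DE r : A r -> D *m r *m invmx D =
    block_mx (ulsubmx r) (ursubmx r *m invmx P) 0 (P *m drsubmx r *m invmx P).
  move=> Ar; rewrite invD -{1}[r]submxK A0 // !mulmx_block.
  by rewrite !(mulmx0, mul0mx, mulmx1, mul1mx, addr0, add0r).
have P_inv r : A r -> (dsubmx P *m drsubmx r <= dsubmx P)%MS.
  by move=> Ar; rewrite PS (eqmxMr _ PS) S_inv.
apply: (sat_conj Du); apply: sat_socle => //.
- exact: subalg_conj.
- by move=> _ [r Ar <-]; rewrite DE // block_mxKdl.
- by move=> _ [r Ar <-]; rewrite DE // block_mxKdr; case: (dsubmx_conj Pu (P_inv r Ar)).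
- move=> v u v0; have [_ [r Ar <-] <-] := top_irr v u v0; exists (ulsubmx r) => //.
  by exists (D *m r *m invmx D); [exists r|rewrite DE // block_mxKul].
- move=> c; have [r Ar <-] := top_full c.
  by exists (D *m r *m invmx D); [exists r|rewrite DE // block_mxKul].
- move=> v u v0; pose vP := v *m dsubmx P.
  have vS w : (w *m dsubmx P <= S)%MS by rewrite -PS submxMl.
  have dPfree w : w *m dsubmx P = 0 -> w = 0.
    move=> wP; have : w *m (dsubmx P *m invmx P) = 0 by rewrite mulmxA wP mul0mx.
    rewrite mul_dsub_mx mulmxV // scalar_mx_block /block_mx col_mxKd mul_mx_row mulmx0 mulmx1.
    by move/(congr1 rsubmx); rewrite row_mxKr linear0.
  (* The orbit of [vP] is a nonzero submodule of [S], hence equal to [S] by minimality. *)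
  have W_lin : linear_set (fun w => exists2 r, A r & vP *m drsubmx r = w).
    split; first by exists 0; [exact: A_lin.1|rewrite linear0 mulmx0].
    move=> c _ _ [x Ax <-] [y Ay <-]; exists (c *: x + y); first exact: A_lin.2.
    by rewrite linearP /= mulmxDr -scalemxAr.
  have [M MW] := linear_set_mx W_lin.
  have MS : (M <= S)%MS.
    apply/row_subP => i; have /MW[r Ar <-] := row_sub i M.
    by apply: submx_trans (S_inv _ Ar); apply/submxMr/vS.
  have SM : (S <= M)%MS.
    rewrite -(geq_leqif (mxrank_leqif_sup MS)); apply: S_min; split.
      apply/eqP => M0; case/eqP: v0; apply: dPfree; apply/eqP.
      rewrite -submx0 -M0; apply/MW; exists 1%:M => //.
      by rewrite drsubmx1 mulmx1.
    move=> r Ar; apply/row_subP => i; rewrite row_mul.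
    have /MW[t At <-] := row_sub i M.
    by apply/MW; exists (t *m r); [exact: AM|rewrite drsubmx_mul ?A0 // mulmxA].
  have /MW[r Ar rE] := submx_trans (vS _ u) SM.
  exists (drsubmx (drsubmx (D *m r *m invmx D))).
    by exists (D *m r *m invmx D) => //; exists r.
  rewrite DE // block_mxKdr; have [_ E] := dsubmx_conj Pu (P_inv r Ar).
  apply/eqP; rewrite -subr_eq0; apply/eqP/dPfree.
  by rewrite mulmxBl -(mulmxA v) -E mulmxA rE subrr.
- move=> _ [r Ar <-]; rewrite DE // block_mxKdr block_mxKul => E; apply: top_dep => //.
  have := congr1 (fun X => invmx P *m (X *m P)) E.
  by rewrite mulmxKV // mulKmx // mul0mx mulmx0.
by apply: IH; rewrite -[X in (X < _)%N]addn0 ltn_add2l.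
Qed.

Lemma reshape_index_cons l ls i :
  reshape_index (l :: ls) i = if (i < l)%N then 0%N else (reshape_index ls (i - l)).+1.
Proof.
rewrite /reshape_index /= -/(i < l)%N.
by case: ltnP => // il; rewrite subSn.
Qed.

Lemma block_upper_triangular_cons l m ls (M : 'M[F]_(l + m)) :
  M \in block_upper_triangular (l :: ls) <->
  dlsubmx M = 0 /\ drsubmx M \in block_upper_triangular ls.
Proof.
have head (i : 'I_l) : reshape_index (l :: ls) i = 0%N.
  by rewrite reshape_index_cons ltn_ord.
have tail i : reshape_index (l :: ls) (l + i) = (reshape_index ls i).+1.
  by rewrite reshape_index_cons ltnNge leq_addr addKn.
split=> [/'forall_'forall_implyP ME|[dl0 /'forall_'forall_implyP ME]].
  split.
    by apply/matrixP => i j; rewrite !mxE; apply/eqP/ME; rewrite /= head tail.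
  by apply/'forall_'forall_implyP => i j ij; rewrite !mxE; apply/ME; rewrite /= !tail.
apply/'forall_'forall_implyP => i j.
case: (split_ordP i) => i' ->; case: (split_ordP j) => j' -> /=; rewrite ?head ?tail //.
  by move=> _; have /matrixP/(_ i' j') := dl0; rewrite !mxE => ->.
by rewrite ltnS => /ME; rewrite !mxE.
Qed.

Lemma maximal_invariant n (A : 'M[F]_n -> Prop) : (0 < n)%N ->
  exists U : 'M_n, [/\ (\rank U < n)%N, forall r, A r -> (U *m r <= U)%MS &
    forall W : 'M_n, (U <= W)%MS -> (forall r, A r -> (W *m r <= W)%MS) ->
      (\rank W < n)%N -> (W <= U)%MS].
Proof.
move=> n_gt0; have [||U [[U_lt U_inv] U_max]] := ex_maxr (f := fun U : 'M[F]_n => \rank U)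
    (P := fun U : 'M[F]_n => (\rank U < n)%N /\ forall r, A r -> (U *m r <= U)%MS) (b := n).
- by exists 0; rewrite mxrank0; split=> // r _; rewrite mul0mx sub0mx.
- by move=> U _; apply: rank_leq_row.
exists U; split=> // W UW W_inv W_lt.
by rewrite -(geq_leqif (mxrank_leqif_sup UW)); apply: U_max.
Qed.

(** The case [n = 0] starts the induction with the empty list. Positivity in the first alternative
    keeps the subtraction exact when the exponents of [V / U] and [U] are added. *)
Lemma nonsat_block_upper n (A : 'M[F]_n -> Prop) : subalg A ->
  ((0 < n)%N /\ sat A (2 * n - 2)) \/
  exists ls (Q : 'M_n), [/\ all (leq 1) ls, sumn ls = n, Q \in unitmx &
    forall r, A r <-> Q *m r *m invmx Q \in block_upper_triangular ls].
Proof.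
elim/ltn_ind: n A => n IH A A_alg.
have A_lin := subalg_linear A_alg.
have AM x y : A x -> A y -> A (x *m y) by case: A_alg => _ _; apply.
have A1 : A 1%:M by case: A_alg.
have [n0|n_gt0] := posnP n.
  right; exists [::], 1%:M; subst n; split=> // [|r]; first exact: unitmx1.
  split=> _; last by rewrite (_ : r = 1%:M) // [LHS]flatmx0 [RHS]flatmx0.
  by apply/'forall_'forall_implyP => -[].
have [U [U_lt U_inv U_max]] := maximal_invariant A n_gt0.
have [l [m [nE [P [Pfree PU mE]]]]] := adapted_basis U.
subst n; have Pu : P \in unitmx by rewrite -row_free_unit.
have l_gt0 : (0 < l)%N by move: U_lt; rewrite -mE; lia.
have P_inv r : A r -> (dsubmx P *m r <= dsubmx P)%MS.
  by move=> Ar; rewrite PU (eqmxMr _ PU) U_inv.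
pose B := conj_set P A.
have B_alg : subalg B by apply: subalg_conj.
have B_lin := subalg_linear B_alg.
have B0 r : B r -> dlsubmx r = 0.
  by case=> x Ax <-; case: (dsubmx_conj Pu (P_inv x Ax)).
have usub_inv : usubmx P *m invmx P = row_mx 1%:M 0.
  by rewrite mul_usub_mx mulmxV // scalar_mx_block /block_mx col_mxKu.
have dsub_inv : dsubmx P *m invmx P = row_mx 0 1%:M.
  by rewrite mul_dsub_mx mulmxV // scalar_mx_block /block_mx col_mxKd.
have B_irr : irred (image_set ulsubmx B).
  move=> v u v0; pose vP := v *m usubmx P.
  (* Modulo [U] these vectors form the orbit of [vP]. They make up a submodule that contains [U]
     strictly, hence all of [V] by maximality. *)
  have W_lin : linear_set (fun w => exists2 r, A r & (w - vP *m r <= U)%MS).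
    split; first by exists 0; [exact: A_lin.1|rewrite mulmx0 subr0 sub0mx].
    move=> c x y [r Ar xr] [t At yt]; exists (c *: r + t); first exact: A_lin.2.
    rewrite mulmxDr -scalemxAr opprD addrACA -scalerBr.
    by rewrite addmx_sub // scalemx_sub.
  have [M MW] := linear_set_mx W_lin.
  have UM : (U <= M)%MS.
    apply/row_subP => i; apply/MW; exists 0; first exact: A_lin.1.
    by rewrite mulmx0 subr0 row_sub.
  have M_full : row_full M.
    rewrite /row_full eqn_leq rank_leq_col /= leqNgt; apply/negP => M_lt.
    have MU : (M <= U)%MS.
      apply: U_max => // r Ar; apply/row_subP => i; rewrite row_mul.
      have /MW[t At it] := row_sub i M; apply/MW; exists (t *m r); first exact: AM.
      by rewrite mulmxA -mulmxBl; apply: submx_trans (U_inv _ Ar); apply: submxMr.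
    have /submx_trans/(_ MU) : (vP <= M)%MS.
      by apply/MW; exists 1%:M => //; rewrite mulmx1 subrr sub0mx.
    rewrite -PU => /submxP[X] /(congr1 (mulmx^~ (invmx P))).
    rewrite /vP -!mulmxA usub_inv dsub_inv !mul_mx_row => /(congr1 lsubmx).
    by rewrite !row_mxKl mulmx1 mulmx0 => /eqP; rewrite (negbTE v0).
  have /MW[r Ar] : (u *m usubmx P <= M)%MS by apply: submx_full.
  rewrite -PU => /submxP[X] /(congr1 (mulmx^~ (invmx P))).
  have -> : (u *m usubmx P - vP *m r) *m invmx P =
      row_mx u 0 - v *m usubmx (P *m r *m invmx P).
    by rewrite mulmxBl -[u *m _ *m _]mulmxA usub_inv mul_mx_row mulmx1 mulmx0
      -!mul_usub_mx /vP !mulmxA.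
  rewrite -(mulmxA X) dsub_inv mul_mx_row mulmx0 => /(congr1 lsubmx).
  rewrite linearB /= !row_mxKl -mulmx_lsub => /eqP; rewrite subr_eq0 => /eqP ->.
  by exists (ulsubmx (P *m r *m invmx P)) => //; exists (P *m r *m invmx P) => //; exists r.
have [B_sat|B_rows] := top_rowsP l_gt0 B_alg B0 B_irr.
  by left; split=> //; apply: sat_conj B_sat.
pose A2 := image_set drsubmx B.
have m_lt : (m < l + m)%N by rewrite -[X in (X < _)%N]add0n ltn_add2r.
have [[m_gt0 A2_sat]|[ls [Q [ls_pos ls_sum Qu A2E]]]] :=
    IH m m_lt A2 (subalg_drsubmx B_alg B0).
  left; split=> //; apply: (sat_conj Pu).
  have -> : (2 * (l + m) - 2 = 2 * l + (2 * m - 2))%N by lia.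
  by apply: sat_block => //; apply: sat_matrix.
pose D : 'M[F]_(l + m) := block_mx 1%:M 0 0 Q.
have [Du invD] : D \in unitmx /\ invmx D = block_mx 1%:M 0 0 (invmx Q).
  by rewrite -[in X in _ = X]invmx1; apply: block_diag_unit; rewrite ?unitmx1.
right; exists (l :: ls), (D *m P); split=> /=; first by rewrite l_gt0.
- by rewrite ls_sum.
- by rewrite unitmx_mul Du.
move=> r; set r' := P *m r *m invmx P.
have -> : D *m P *m r *m invmx (D *m P) = block_mx (ulsubmx r') (ursubmx r' *m invmx Q)
    (Q *m dlsubmx r') (Q *m drsubmx r' *m invmx Q).
  have -> : invmx (D *m P) = invmx P *m invmx D.
    have DPu : D *m P \in unitmx by rewrite unitmx_mul Du.
    rewrite -[RHS](mulKmx DPu) -[LHS]mulmx1; congr (_ *m _).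
    by rewrite mulmxA -(mulmxA D) mulmxV // mulmx1 mulmxV.
  rewrite !mulmxA -!(mulmxA D) -/r' -{1}[r']submxK invD /D !mulmx_block.
  by rewrite !(mulmx0, mul0mx, mulmx1, mul1mx, addr0, add0r) mulmxA.
rewrite block_upper_triangular_cons block_mxKdl block_mxKdr -A2E.
have AB : A r <-> B r'.
  split=> [Ar|[t At tE]]; first by exists r.
  have := congr1 (fun X => invmx P *m (X *m P)) tE.
  by rewrite !mulmxKV // !mulKmx // => <-.
rewrite AB; split=> [Br|[dl0 [t Bt tE]]].
  by rewrite B0 // mulmx0; split=> //; exists r'.
have {dl0} dl0 : dlsubmx r' = 0.
  by rewrite -[LHS](mulKmx Qu) dl0 mulmx0.
(* [t] in [B] has the same action on [U] as [r']; their difference vanishes on [U] and lies in [B]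
   by [B_rows]. *)
have -> : r' = block_mx (ulsubmx r' - ulsubmx t) (ursubmx r' - ursubmx t) 0 0 + t.
  rewrite -[t in _ + t]submxK -{1}[r']submxK tE dl0 B0 // add_block_mx.
  by rewrite !subrK !add0r.
exact: linear_setD.
Qed.

End Main.

Theorem theorem3p3 (F : fieldType) (n : nat) (n_gt0 : (0 < n)%N)
    (A : {vspace 'M[F]_n}) (A_subalg : GRing.mulr_closed A)
    (A_nstd : ~ satisfies_standard A (2 * n - 2)) :
  exists (t : nat) (l : t.-tuple nat),
    [/\ (0 < t)%N, all (leq 1) l, sumn l = n
      & equivalent A (block_upper_triangular l)].
Proof.
have [A1 AM] := A_subalg.
have A_alg : subalg (fun r => r \in A).
  by split=> // c x y Ax Ay; apply: memvD => //; apply: memvZ.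
have [[_ A_sat]|[ls [Q [ls_pos ls_sum Qu AE]]]] := nonsat_block_upper A_alg.
  by case: A_nstd => r Ar; apply: A_sat.
exists (size ls), (in_tuple ls); split=> //.
  by case: ls ls_sum {ls_pos AE} => //= n0; move: n_gt0; rewrite -n0.
pose f (r : 'M[F]_n) := Q *m r *m invmx Q.
have fB : zmod_morphism f by move=> x y; rewrite /f mulmxBr mulmxBl.
have fM : monoid_morphism f.
  by split=> [|x y]; rewrite /f ?mulmx1 ?mulmxV // -!mulmxE !mulmxA mulmxKV.
pose tau : {rmorphism 'M[F]_n -> 'M[F]_n} :=
  HB.pack f (GRing.isZmodMorphism.Build _ _ f fB) (GRing.isMonoidMorphism.Build _ _ f fM).
exists tau; split.
- by move=> c x; rewrite /= /f -scalemxAr -scalemxAl.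
- exists (fun r => invmx Q *m r *m Q) => r; rewrite /= /f.
    by rewrite !mulmxA mulmxKV // mulVmx // mul1mx.
  by rewrite !mulmxA mulmxK // mulmxV // mul1mx.
move=> b; split=> [bE|[r Ar <-]]; last exact/AE.
exists (invmx Q *m b *m Q); first by apply/AE; rewrite !mulmxA mulmxK // mulmxV // mul1mx.
by rewrite /= /f !mulmxA mulmxK // mulmxV // mul1mx.
Qed.
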